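(* Let $m$ be a positive integer, let $\mathrm{type}$ be a type attribution for $e_n^m$, and let $F_{m,k}:\mathrm{SYT}_m^k\to\mathrm{SYT}_m$ be a Kronecker map. Let $\lambda=(\lambda_1,\dots,\lambda_k)$ be a partition and $e_\lambda=e_{\lambda_1}\cdots e_{\lambda_k}$. For a conjugate tableau $T'$ of content $\lambda^m$ with $\mathrm{Dec}'_m(T')=(T'_1,\dots,T'_k)$, define $\mathrm{type}(T')=F_{m,k}(\mathrm{type}(T'_1),\dots,\mathrm{type}(T'_k))$. Then for every $t\in\mathrm{SYT}_m$, $$s_{\mathrm{shape}(t)}[e_\lambda]=\sum_{T'} s_{\mathrm{shape}(T')},$$ the sum running over all conjugate tableaux $T'$ of content $\lambda^m$ with $\mathrm{type}(T')=t$.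
   Context: A conjugate tableau is a filling of a (possibly skew) Young diagram by positive integers with entries strictly increasing along rows and weakly increasing down columns; equivalently the transpose of a semistandard tableau (rows weakly increasing, columns strictly increasing). $\mathrm{SYT}_m$: standard Young tableaux with $m$ cells. $s_\mu$ Schur functions, $e_n=s_{(1^n)}$, $f[g]$ plethysm. A type attribution for $e_n^m$ is a function $\mathrm{type}$ from the set of all conjugate tableaux of content $(n)^m$ (each of $1,\dots,m$ occurring $n$ times), over all $n\ge1$ and shapes, to $\mathrm{SYT}_m$, such that for all $n\ge1$, $t\in\mathrm{SYT}_m$: $s_{\mathrm{shape}(t)}[e_n]=\sum_{T'\text{ of content }(n)^m,\ \mathrm{type}(T')=t}s_{\mathrm{shape}(T')}$. A Kronecker map is a map $F_{m,k}:\mathrm{SYT}_m^k\to\mathrm{SYT}_m$ such that for all symmetric functions $f_1,\dots,f_k$ and $t\in\mathrm{SYT}_m$, $s_{\mathrm{shape}(t)}[f_1\cdots f_k]=\sum_{(t_1,\dots,t_k)\in F_{m,k}^{-1}(t)}\prod_i s_{\mathrm{shape}(t_i)}[f_i]$. Content $\lambda^m$: for each $i\le k$, $r\le m$, the entry $(i-1)m+r$ appears $\lambda_i$ times. For such $T'$, let $\widetilde{T'}^{(i)}$ be the skew conjugate tableau of cells with entries in $\{(i-1)m+1,\dots,im\}$ with $(i-1)m$ subtracted from each entry; set $T'_i=\big(\mathrm{Rect}((\widetilde{T'}^{(i)})')\big)'$, where $'$ denotes transposition and $\mathrm{Rect}$ is rectification by Schützenberger's jeu de taquin; then $\mathrm{Dec}'_m(T')=(T'_1,\dots,T'_k)$.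 *)

(* Defs.v *)
From HB Require Import structures.
From mathcomp Require Import all_boot all_order all_algebra.
From mathcomp Require Import boolp classical_sets.
From mathcomp Require Import mpoly.

Set Implicit Arguments.
Unset Strict Implicit.
Unset Printing Implicit Defensive.

Import GRing.Theory.
Local Open Scope ring_scope.

(** * Symmetric functions

   A function in the variables x_1, x_2, ... is given by its truncations
   f(x_1, ..., x_n, 0, 0, ...), one polynomial for each n (the variable x_(i+1)
   is ['X_i]).  All families form a ring for the pointwise operations; the
   symmetric functions are the families satisfying [symfun].  The coefficients
   are rational because plethysm is defined through power sums. *)

Definition family := forall n : nat, {mpoly rat[n]}.

HB.instance Definition _ := gen_eqMixin family.
HB.instance Definition _ := gen_choiceMixin family.

Section FamilyRing.

Definition fam_zero : family := fun=> 0.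
Definition fam_one : family := fun=> 1.
Definition fam_opp (f : family) : family := fun n => - f n.
Definition fam_add (f g : family) : family := fun n => f n + g n.
Definition fam_mul (f g : family) : family := fun n => f n * g n.

Let famP (f g : family) : (forall n, f n = g n) -> f = g.
Proof. exact: functional_extensionality_dep. Qed.

Lemma fam_addA : associative fam_add.
Proof. by move=> f g h; apply: famP => n; apply: addrA. Qed.
Lemma fam_addC : commutative fam_add.
Proof. by move=> f g; apply: famP => n; apply: addrC. Qed.
Lemma fam_add0 : left_id fam_zero fam_add.
Proof. by move=> f; apply: famP => n; apply: add0r. Qed.
Lemma fam_addN : left_inverse fam_zero fam_opp fam_add.
Proof. by move=> f; apply: famP => n; apply: addNr. Qed.
Lemma fam_mulA : associative fam_mul.
Proof. by move=> f g h; apply: famP => n; apply: mulrA. Qed.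
Lemma fam_mulC : commutative fam_mul.
Proof. by move=> f g; apply: famP => n; apply: mulrC. Qed.
Lemma fam_mul1 : left_id fam_one fam_mul.
Proof. by move=> f; apply: famP => n; apply: mul1r. Qed.
Lemma fam_mulD : left_distributive fam_mul fam_add.
Proof. by move=> f g h; apply: famP => n; apply: mulrDl. Qed.
Lemma fam_1neq0 : fam_one != fam_zero.
Proof.
apply/eqP => /(congr1 (fun f : family => f 0)) /eqP.
by rewrite /fam_one /fam_zero oner_eq0.
Qed.

End FamilyRing.

HB.instance Definition _ :=
  GRing.isZmodule.Build family fam_addA fam_addC fam_add0 fam_addN.
HB.instance Definition _ :=
  GRing.Zmodule_isComNzRing.Build family
    fam_mulA fam_mulC fam_mul1 fam_mulD fam_1neq0.

(* Setting the last variable to 0. *)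
Definition drop_last n (p : {mpoly rat[n.+1]}) : {mpoly rat[n]} :=
  p \mPo [tuple if unlift ord_max i is Some j then 'X_j else 0 | i < n.+1].

Definition symfun (f : family) : Prop :=
  [/\ forall n, f n \is symmetric,
      forall n, drop_last (f n.+1) = f n
    & exists d, forall n, (msize (f n) <= d)%N].

(** ** Plethysm

   For fixed g, the map f |-> f[g] is the morphism of Q-algebras sending the
   power sum p_k to p_k[g] = g(x_1^k, x_2^k, ...).  Every symmetric function is
   a polynomial in finitely many power sums, and in only one way, so that the
   value selected by [plethysm] exists and is unique when f is symmetric. *)

Definition power_sum (k : nat) : family := fun n => \sum_(i < n) 'X_i ^+ k.

Definition adams (k : nat) (g : family) : family :=
  fun n => g n \mPo [tuple 'X_i ^+ k | i < n].

(* P(v_1, ..., v_d) *)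
Definition eval_poly d (P : {mpoly rat[d]}) (v : nat -> family) : family :=
  fun n => P \mPo [tuple v i.+1 n | i < d].

Definition plethysm (f g : family) : family :=
  xget 0 [set h | exists d (P : {mpoly rat[d]}),
            f = eval_poly P power_sum /\ h = eval_poly P (adams^~ g)]%classic.

(** * Tableaux

   A tableau is the list of its rows, read from top to bottom (English
   convention), so that [shape T] is the list of the row lengths.  In a skew
   tableau of shape lambda/mu the cells of mu are filled with 0; all other
   entries are positive. *)

Notation tableau := (seq (seq nat)).

Definition is_part (mu : seq nat) : bool :=
  sorted geq mu && all (leq 1) mu.

(* The j-th row of [transpose T] is the j-th column of T. *)
Definition transpose (T : tableau) : tableau :=
  [seq [seq nth 0 r j | r <- T & j < size r] | j <- iota 0 (size (head [::] T))]%N.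

(* Fillings of the Young diagrams with N cells by the integers 1, ..., K. *)
Definition is_filling N K (T : tableau) : bool :=
  [&& is_part (shape T), sumn (shape T) == N
    & all (all (fun x => 1 <= x <= K)%N) T].

Record filling N K :=
  Filling { fval :> tableau; fvalP : is_filling N K fval }.

HB.instance Definition _ N K := [isSub of filling N K for @fval N K].
HB.instance Definition _ N K := [Choice of filling N K by <:].

Section FillingFinite.

Variables N K : nat.

Definition short_words L B : seq (seq nat) :=
  [seq [seq val x | x <- tval w]
     | n <- iota 0 L.+1, w <- enum {: n.-tuple 'I_B.+1}].

Lemma mem_short_words L B s :
  (size s <= L)%N -> all (fun x => x <= B)%N s -> s \in short_words L B.
Proof.
move=> sL sB; apply/allpairsPdep.
exists (size s), [tuple of [seq inord x : 'I_B.+1 | x <- in_tuple s]].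
rewrite mem_iota /= ltnS sL mem_enum; split=> //=.
rewrite -map_comp -[LHS]map_id; apply/eq_in_map => x /(allP sB) xB /=.
by rewrite inordK.
Qed.

Definition all_fillings : seq (filling N K) :=
  undup (pmap insub [seq reshape sh w | sh <- short_words N N,
                                        w <- short_words N K]).

Lemma all_fillingsP : Finite.axiom all_fillings.
Proof.
apply: Finite.uniq_enumP; first exact: undup_uniq.
move=> [T TP]; rewrite mem_undup inE mem_pmap_sub /=.
have /and3P[/andP[_ /allP pos] /eqP sN TK] := TP.
apply/allpairsP; exists (shape T, flatten T); split=> /=; last first.
- by rewrite flattenK.
- apply: mem_short_words; first by rewrite size_flatten -/(shape T) sN.
  apply/allP => x /flattenP[r rT xr].
  by have /allP/(_ x xr)/andP[] := allP TK r rT.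
apply: mem_short_words.
- rewrite -sN -sum1_size sumnE.
  by rewrite big_seq [leqRHS]big_seq; apply: leq_sum => i /pos.
- apply/allP => x xT; rewrite -sN sumnE.
  by rewrite (perm_big _ (perm_to_rem xT)) big_cons leq_addr.
Qed.

End FillingFinite.

HB.instance Definition _ N K := [Countable of filling N K by <:].
HB.instance Definition _ N K :=
  isFinite.Build (filling N K) (@all_fillingsP N K).

(* [content K T] lists the multiplicities of 1, ..., K in T. *)
Definition content K (T : tableau) : seq nat :=
  [seq count_mem i (flatten T) | i <- iota 1 K].

Definition semistandard (T : tableau) : bool :=
  all (sorted leq) T && all (sorted ltn) (transpose T).

Definition conjugate_tableau (T : tableau) : bool :=
  all (sorted ltn) T && all (sorted leq) (transpose T).

Definition SYT m :=
  {T : filling m m | semistandard T && (content m T == nseq m 1%N)}.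

(* Conjugate tableaux of content c = (c_1, ..., c_K): i occurs c_i times. *)
Definition conj_tab (c : seq nat) :=
  {T : filling (sumn c) (size c)
  | conjugate_tableau T && (content (size c) T == c)}.

HB.instance Definition _ m := Finite.on (SYT m).
HB.instance Definition _ c := Finite.on (conj_tab c).

Coercion tableau_of_SYT m (t : SYT m) : tableau := sval t.
Coercion tableau_of_conj_tab c (T : conj_tab c) : tableau := sval T.

(** ** Schur functions *)

Definition tab_monomial n (T : tableau) : 'X_{1..n} :=
  [multinom count_mem (i : nat).+1 (flatten T) | i < n].

Definition schur (mu : seq nat) : family := fun n =>
  \sum_(T : filling (sumn mu) n | semistandard T && (shape T == mu))
    'X_[tab_monomial n T].

Definition elementary (n : nat) : family := schur (nseq n 1%N).

(** ** Jeu de taquin *)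

Section JeuDeTaquin.
Local Open Scope nat_scope.

Implicit Type T : tableau.

(* 0 outside of the diagram *)
Definition entry T r c := nth 0 (nth [::] T r) c.

Definition set_entry T r c x :=
  set_nth [::] T r (set_nth 0 (nth [::] T r) c x).

(* Slides the hole in cell (r, c) outwards, as long as it has a right or a lower
   neighbour; the smaller neighbour is moved into the hole, the lower one if
   they are equal.  The hole ends in an outer corner, which is removed. *)
Fixpoint slide_hole fuel T r c : tableau :=
  if fuel is fuel'.+1 then
    let right := entry T r c.+1 in
    let below := entry T r.+1 c in
    if (0 < below) && ((right == 0) || (below <= right)) then
      slide_hole fuel' (set_entry T r c below) r.+1 c
    else if 0 < right then
      slide_hole fuel' (set_entry T r c right) r c.+1
    else set_nth [::] T r (take c (nth [::] T r))
  else T.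

(* A jeu de taquin slide into the lowest inner corner. *)
Definition jdt_slide T : tableau :=
  let r := (count (fun row => 0 \in row) T).-1 in
  let c := (count_mem 0 (nth [::] T r)).-1 in
  slide_hole (size (flatten T)) T r c.

(* Rectification: by Schutzenberger's theorem, the order in which the inner
   corners are chosen is irrelevant. *)
Definition Rect T : tableau :=
  [seq row <- iter (count_mem 0 (flatten T)) jdt_slide T | row != [::]].

(* The cells with entries in {im + 1, ..., (i + 1)m}, lowered by im; the smaller
   entries become 0 by truncated subtraction, so that they form the inner
   shape. *)
Definition skew_part m i T : tableau :=
  [seq [seq x - i * m | x <- row & x <= i.+1 * m] | row <- T].

Definition Dec_component m i T : tableau :=
  transpose (Rect (transpose (skew_part m i T))).

End JeuDeTaquin.

(* Dec'_m(T) for T of content lambda^m, where k is the length of lambda *)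
Definition Dec m k (T : tableau) : k.-tuple tableau :=
  [tuple Dec_component m i T | i < k].

(* lambda^m: for i < k and 1 <= r <= m, the entry im + r occurs lambda_i times *)
Definition content_pow (lam : seq nat) m : seq nat :=
  flatten [seq nseq m l | l <- lam].

(** * Type attributions and Kronecker maps *)

(* The values of [type] outside of the conjugate tableaux of content (n)^m,
   n >= 1, are irrelevant. *)
Definition type_attribution m (type : tableau -> SYT m) : Prop :=
  forall n, (0 < n)%N -> forall t : SYT m,
    plethysm (schur (shape t)) (elementary n) =
    \sum_(T : conj_tab (nseq m n) | type T == t) schur (shape T).

Definition Kronecker_map m k (F : k.-tuple (SYT m) -> SYT m) : Prop :=
  forall f : 'I_k -> family, (forall i, symfun (f i)) ->
  forall t : SYT m,
    plethysm (schur (shape t)) (\prod_(i < k) f i) =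
    \sum_(ts : k.-tuple (SYT m) | F ts == t)
      \prod_(i < k) plethysm (schur (shape (tnth ts i))) (f i).

Definition extended_type m k (type : tableau -> SYT m)
    (F : k.-tuple (SYT m) -> SYT m) (T : tableau) : SYT m :=
  F (map_tuple type (Dec m k T)).

(* Main.v *)
(** Transposed, a conjugate tableau of content lambda^m is a semistandard tableau,
   that is a chain of partitions whose steps are horizontal strips, and Dec'_m
   cuts this chain into k skew tableaux and rectifies them.  Granted the Kronecker
   map and the type attribution, the theorem amounts to the identity
     s_(mu') s_(nu') = \sum_S s_(shape(S)'),
   S ranging over the skew semistandard tableaux of inner shape mu that rectify to
   a fixed tableau U of shape nu, where ' is transposition.

   Rectification is tableau switching with the superstandard tableau of shape mu,
   which is computed by Bender-Knuth's rule on horizontal strips.  Switching is an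
   involution, and it preserves the Yamanouchi condition; so the tableaux S are in
   bijection with the Yamanouchi tableaux of inner shape nu and content mu, and the
   sum depends on U only through nu.  By Pieri's rule the identity holds after
   summation over all U of content nu; an induction on \sum_i i nu_i extracts the
   contribution of the superstandard U, since Kostka matrices are unitriangular. *)

(* The obstacle is a mismatch of scale: a jeu de taquin slide moves one hole through a list of rows,
   whereas Bender-Knuth's rule moves a whole strip between shapes. The bridge is that the hole
   always sits in the rightmost cell of the strip being switched, so that the slides starting in one
   row of the superstandard tableau compose to one strip switch. Once this is known, all bijections
   take place in a rectangular grid of partitions in which every square satisfies the same
   involutive rule. Such a grid is determined by its upper row and left column, and equally by the
   two opposite sides; rectification with its record reads off the second pair of sides, and its
   inverse starts from that pair. Schur functions enter through their conjugates in finitely many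
   variables, so that Pieri's rule for elementary symmetric functions adds horizontal strips, the
   steps of the chains. *)
Require Import Defs.
From mathcomp Require Import all_boot all_order all_algebra.
From mathcomp Require Import boolp perm mpoly zify ring.

Set Implicit Arguments.
Unset Strict Implicit.
Unset Printing Implicit Defensive.

Import GRing.Theory.
Local Open Scope nat_scope.

(** * Switching of horizontal strips *)

(* A partition is given by its row lengths. *)
Notation rows := (nat -> nat).

Definition noninc (f : rows) := forall i, f i.+1 <= f i.

(* [g / f] is a horizontal strip; in particular [f] and [g] are non-increasing. *)
Definition hstrip (f g : rows) := forall i, g i.+1 <= f i <= g i.

Definition psum (f : rows) r := \sum_(0 <= q < r) f q.

Lemma psum0 f : psum f 0 = 0.
Proof. by rewrite /psum big_nil. Qed.

Lemma psumS f r : psum f r.+1 = psum f r + f r.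
Proof. by rewrite /psum big_nat_recr. Qed.

Lemma noninc_le f i j : noninc f -> i <= j -> f j <= f i.
Proof.
move=> nf /subnK <-; elim: (j - i) => // d IH.
exact: leq_trans (nf _) IH.
Qed.

Lemma hstrip_noninc f g : hstrip f g -> noninc f /\ noninc g.
Proof. by move=> h; split=> i; move: (h i) (h i.+1); lia. Qed.

Lemma hstrip_refl f : noninc f -> hstrip f f.
Proof. by move=> nf i; rewrite nf leqnn. Qed.

(* Bender-Knuth's rule: for horizontal strips [Y / X] and [Z / Y] it returns the
   partition [W] for which [W / X] and [Z / W] are the switched strips.  Row [q]
   of [Y] ranges over an interval, which the rule reflects; for [q = 0] the upper
   end is [Z 0]. *)
Definition bk (X Y Z : rows) : rows := fun q =>
  maxn (X q) (Z q.+1) + (if q is q'.+1 then minn (Z q) (X q') else Z q) - Y q.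

Section LocalRule.

Variables X Y Z : rows.
Hypotheses (hXY : hstrip X Y) (hYZ : hstrip Y Z).

Lemma bk_add q : bk X Y Z q + Y q =
  maxn (X q) (Z q.+1) + (if q is q'.+1 then minn (Z q) (X q') else Z q).
Proof.
rewrite /bk; move: (hXY q) (hYZ q); case: q => [|q]; first by lia.
by move: (hXY q) (hYZ q); lia.
Qed.

Lemma bk_hstripl : hstrip X (bk X Y Z).
Proof.
move=> q; have := bk_add q.+1; have := bk_add q; rewrite /=.
move: (hXY q) (hYZ q) (hXY q.+1) (hYZ q.+1).
by case: q => [|q]; [lia | move: (hXY q) (hYZ q); lia].
Qed.

Lemma bk_hstripr : hstrip (bk X Y Z) Z.
Proof.
move=> q; have := bk_add q; have := bk_add q.+1.
move: (hXY q) (hYZ q) (hXY q.+1) (hYZ q.+1).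
by case: q => [|q]; [lia | move: (hXY q) (hYZ q); lia].
Qed.

Lemma bk_invol : bk X (bk X Y Z) Z = Y.
Proof. by apply: funext => q; rewrite {1}/bk -(bk_add q) addKn. Qed.

(** Since [maxn a b + minn a b = a + b], the upper end of row [q.+1] completes the lower end of row
    [q] and the sum telescopes; only the lower end of row [r] is left over. *)
Lemma psum_bk r : psum (bk X Y Z) r.+1 + psum Y r.+1 =
  psum Z r.+1 + psum X r + maxn (X r) (Z r.+1).
Proof.
elim: r => [|r IH]; first by rewrite !psumS !psum0 !add0n bk_add /= addnC addn0.
by rewrite psumS [psum Y _]psumS addnACA IH bk_add /= !psumS; lia.
Qed.

(** [r] is the row of the rightmost cell of Y / X, which plays the hole. The cell below it is not in
    [Z], so the hole stays in row [r]: this is again the first row in which the switched strip has a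
    cell. *)
Lemma bk_min_cell r : (forall q, q < r -> X q = Y q) -> X r < Y r ->
  Z r.+1 < Y r -> (forall q, q < r -> bk X Y Z q = Z q) /\ bk X Y Z r < Z r.
Proof.
move=> eqr ltr ltZ; split.
  move=> q qr; have := bk_add q; have := eqr _ qr.
  case: q qr => [|q] qr; first by move: (hXY 0) (hYZ 0); lia.
  have := eqr q (ltnW qr).
  by move: (hXY q) (hYZ q) (hXY q.+1) (hYZ q.+1); lia.
have := bk_add r; case: r eqr ltr ltZ => [|r] eqr ltr ltZ.
  by move: (hXY 0) (hYZ 0); lia.
have := eqr r (leqnn _).
by move: (hXY r) (hYZ r) (hXY r.+1) (hYZ r.+1); lia.
Qed.

(** Here the cell below the hole lies in [Z], so the hole drops by one row. *)
Lemma bk_min_cellS r : (forall q, q < r -> X q = Y q) -> X r < Y r ->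
  Z r.+1 = Y r -> (forall q, q <= r -> bk X Y Z q = Z q) /\
  bk X Y Z r.+1 < Z r.+1.
Proof.
move=> eqr ltr eqZ; split.
  move=> q; rewrite leq_eqVlt => /predU1P[->|qr].
    have := bk_add r; case: r eqr ltr eqZ => [|r] eqr ltr eqZ.
      by move: (hXY 0) (hYZ 0); lia.
    have := eqr r (leqnn _).
    by move: (hXY r) (hYZ r) (hXY r.+1) (hYZ r.+1); lia.
  have := bk_add q; have := eqr _ qr.
  case: q qr => [|q] qr; first by move: (hXY 0) (hYZ 0); lia.
  have := eqr q (ltnW qr).
  by move: (hXY q) (hYZ q) (hXY q.+1) (hYZ q.+1); lia.
by have := bk_add r.+1; move: (hXY r) (hYZ r) (hXY r.+1) (hYZ r.+1); lia.
Qed.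

End LocalRule.

Lemma bk_const X Z : hstrip X Z -> bk X Z Z = X.
Proof.
move=> h; apply: funext => q; rewrite /bk.
by move: (h q); case: q => [|q]; [lia | move: (h q); lia].
Qed.

Lemma bk_id Y Z : hstrip Y Z -> bk Y Y Z = Z.
Proof.
move=> h; apply: funext => q; rewrite /bk.
by move: (h q); case: q => [|q]; [lia | move: (h q); lia].
Qed.

(* A tableau as the chain of the shapes of its entries that are at most j; the
   chain of a finite tableau is eventually constant. *)
Notation chain := (nat -> rows).

Definition hchain (M : chain) := forall j, hstrip (M j) (M j.+1).

Definition stable m (M : chain) := forall j, m <= j -> M j = M m.

(* The strip from [X] to [M 0] is switched past all the strips of [M]; the result
   starts from [X]. *)
Fixpoint bkc (M : chain) (X : rows) j : rows :=
  if j is j'.+1 then bk (bkc M X j') (M j') (M j'.+1) else X.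

Section SwitchStrip.

Variables (M : chain) (X : rows).
Hypotheses (hM : hchain M) (hX : hstrip X (M 0)).

Lemma bkc_hstrip j : hstrip (bkc M X j) (M j).
Proof. by elim: j => [|j IH] //=; apply: bk_hstripr. Qed.

Lemma bkc_hchain : hchain (bkc M X).
Proof. by move=> j; apply: bk_hstripl => //; apply: bkc_hstrip. Qed.

Lemma bkc_stable m : stable m M -> stable m (bkc M X).
Proof.
move=> sM j /subnK <-; elim: (j - m) => // d IH.
rewrite addSn /= IH (sM _ (leq_addl _ _)) (sM (d + m).+1 _).
  by apply: bk_const; apply: bkc_hstrip.
by rewrite leqW // leq_addl.
Qed.

End SwitchStrip.

Lemma bkc_id M : hchain M -> bkc M (M 0) = M.
Proof.
by move=> hM; apply: funext => j; elim: j => //= j ->; apply: bk_id.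
Qed.

(* [grid l a M] has [M] as its row [l] and [a] as its column 0. *)
Fixpoint down (l : nat) (a M : chain) d : chain :=
  if d is d'.+1 then bkc (down l a M d') (a (l - d'.+1)) else M.

Definition grid l a M i : chain := down l a M (l - i).

Definition local_rule (G : nat -> chain) :=
  forall i j, G i j.+1 = bk (G i j) (G i.+1 j) (G i.+1 j.+1).

Lemma down_ind l (P : nat -> Prop) :
  (forall i, l <= i -> P i) -> (forall i, i < l -> P i.+1 -> P i) ->
  forall i, P i.
Proof.
move=> Ptop Pstep i; have [il|/Ptop//] := ltnP i l.
have [d] := ubnP (l - i); elim: d i il => // d IH i il le.
apply: Pstep => //; have [il'|/Ptop//] := ltnP i.+1 l.
by apply: IH => //; lia.
Qed.

Section Grid.

Variables (l m : nat) (a M : chain).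
Hypotheses (hM : hchain M) (ha : hchain a) (sM : stable m M) (sa : stable l a).
Hypothesis aM : a l = M 0.

Let G := grid l a M.

Lemma grid_top i : l <= i -> G i = M.
Proof. by rewrite -subn_eq0 /G /grid => /eqP->. Qed.

Lemma grid_rec i : i < l -> G i = bkc (G i.+1) (a i).
Proof. by move=> il; rewrite /G /grid -(subnSK il) /= subnSK // subKn // ltnW. Qed.

Lemma grid_col0 i : G i 0 = a i.
Proof.
have [il|li] := ltnP i l; first by rewrite grid_rec.
by rewrite grid_top // -aM -(sa li).
Qed.

Lemma grid_hchain i : hchain (G i).
Proof.
elim/(@down_ind l): i => [i /grid_top-> //|i il IH].
by rewrite grid_rec //; apply: bkc_hchain => //; rewrite grid_col0.
Qed.

Lemma grid_recE i : G i = bkc (G i.+1) (a i).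
Proof.
have [|li] := ltnP i l; first exact: grid_rec.
by rewrite !grid_top ?leqW // (sa li) aM bkc_id.
Qed.

Lemma grid_local : local_rule G.
Proof. by move=> i j; rewrite {1 2}grid_recE. Qed.

Lemma grid_vstrip i j : hstrip (G i j) (G i.+1 j).
Proof.
rewrite grid_recE; apply: bkc_hstrip; first exact: grid_hchain.
by rewrite grid_col0.
Qed.

Lemma grid_stable i : stable m (G i).
Proof.
elim/(@down_ind l): i => [i /grid_top-> //|i il IH].
rewrite grid_rec //; apply: bkc_stable => //; first exact: grid_hchain.
by rewrite grid_col0.
Qed.

(* As [bk] is an involution, the grid can be recomputed from its row 0 and its
   column [m]. *)
Lemma grid_transpose i j : grid m (G 0) (fun i => G i m) j i = G i j.
Proof.
elim/(@down_ind m): j i => [j mj|j jm IH] i.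
  have -> : grid m (G 0) (fun i => G i m) j = (fun i => G i m).
    by move: mj; rewrite /grid -subn_eq0 => /eqP ->.
  by rewrite (@grid_stable i j mj).
have -> : grid m (G 0) (fun i => G i m) j =
    bkc (grid m (G 0) (fun i => G i m) j.+1) (G 0 j).
  by rewrite /grid -(subnSK jm) /= subnSK // subKn // ltnW.
elim: i => [|i IHi] //=; rewrite IHi !IH grid_local.
by apply: bk_invol; [apply: grid_vstrip | apply: grid_hchain].
Qed.

Lemma local_rule_psum r i j :
  psum (G i j.+1) r.+1 + psum (G i.+1 j) r.+1 =
  psum (G i.+1 j.+1) r.+1 + psum (G i j) r + maxn (G i j r) (G i.+1 j.+1 r.+1).
Proof.
rewrite grid_local; apply: psum_bk; [exact: grid_vstrip|exact: grid_hchain].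
Qed.

End Grid.

(* The rows before [r.+1] of [X2 / X1] have at most as many cells as the rows
   before [r] of [X1 / X0]; written without subtraction. *)
Definition yam3 (X0 X1 X2 : rows) := forall r,
  psum X2 r.+1 + psum X0 r <= psum X1 r.+1 + psum X1 r.

Definition yamanouchi (A : chain) := forall i, yam3 (A i) (A i.+1) (A i.+2).

(** * Invariance of the Yamanouchi condition under switching *)

Section Yamanouchi.

Variables X0 X1 X2 Z0 Z1 Z2 : rows.
Hypotheses (h01 : hstrip X0 X1) (h12 : hstrip X1 X2).
Hypotheses (k01 : hstrip Z0 Z1) (k12 : hstrip Z1 Z2).
Hypotheses (h0 : hstrip X0 Z0) (h1 : hstrip X1 Z1) (h2 : hstrip X2 Z2).
Hypotheses (e0 : Z0 = bk X0 X1 Z1) (e1 : Z1 = bk X1 X2 Z2).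

Let p0 r : psum Z0 r.+1 + psum X1 r.+1 =
  psum Z1 r.+1 + psum X0 r + maxn (X0 r) (Z1 r.+1).
Proof. by rewrite e0; apply: psum_bk. Qed.

Let p1 r : psum Z1 r.+1 + psum X2 r.+1 =
  psum Z2 r.+1 + psum X1 r + maxn (X1 r) (Z2 r.+1).
Proof. by rewrite e1; apply: psum_bk. Qed.

Let q0 q : Z0 q + X1 q =
  maxn (X0 q) (Z1 q.+1) + (if q is q'.+1 then minn (Z1 q) (X0 q') else Z1 q).
Proof. by rewrite e0 bk_add. Qed.

Let q1 q : Z1 q + X2 q =
  maxn (X1 q) (Z2 q.+1) + (if q is q'.+1 then minn (Z2 q) (X1 q') else Z2 q).
Proof. by rewrite e1 bk_add. Qed.

(** By [p0] and [p1], the inequality for [Z] at [r.+1] reduces to the one for [X] at [r.+1] if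
    [X0 r] attains [maxn (X0 r) (Z1 r.+1)], and to the one at [r], by [q1], if [Z1 r.+1] does. *)
Lemma yam3_slide : yam3 X0 X1 X2 -> yam3 Z0 Z1 Z2.
Proof.
move=> Y r; case: r => [|r].
  have := Y 0; have := p1 0; rewrite !psumS !psum0.
  by move: (h12 0) (h1 0) (k12 0) (k12 1) (h2 0); lia.
have := Y r; have := Y r.+1; have := p0 r; have := p1 r; have := p1 r.+1.
have := q1 r.+1; rewrite !psumS.
by move: (h01 r) (h12 r) (k01 r) (k12 r) (h0 r) (h1 r) (h2 r); lia.
Qed.

(** The converse splits on [maxn (X1 r.+1) (Z2 r.+2)]: the inequality for [X] at [r.+1] follows from
    the one for [Z] at [r.+1] or, by [q0], at [r.+2]. *)
Lemma yam3_unslide : yam3 Z0 Z1 Z2 -> yam3 X0 X1 X2.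
Proof.
move=> Y r; case: r => [|r].
  have := Y 0; have := Y 1; have := p1 0; have := p0 0; have := q0 0.
  have := q1 0; rewrite !psumS !psum0.
  by move: (h12 0) (h1 0) (k12 0) (k12 1) (h2 0) (k01 0) (k01 1); lia.
have := Y r.+1; have := Y r.+2; have := p0 r; have := p1 r; have := p1 r.+1.
have := q0 r.+1; rewrite !psumS.
by move: (h01 r) (h12 r) (k01 r) (k12 r) (h0 r) (h1 r) (h2 r) (k01 r.+1); lia.
Qed.

End Yamanouchi.

(** * Slides and Yamanouchi chains *)

Definition rows0 : rows := fun=> 0.

(** As a chain in [i], this is the superstandard tableau of shape [mu], whose row [i] is filled with
    [i.+1]. *)
Definition trunc i (mu : rows) : rows := fun r => if r < i then mu r else 0.

Lemma trunc_hstrip mu i : noninc mu -> hstrip (trunc i mu) (trunc i.+1 mu).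
Proof.
move=> nm q; rewrite /trunc; move: (nm q).
by case: ltnP => ?; case: ltnP => ?; case: ltnP => ?; lia.
Qed.

Lemma trunc_yamanouchi mu : noninc mu -> yamanouchi (trunc^~ mu).
Proof.
move=> nm i r.
have psum_trunc k s : psum (trunc k mu) s = psum mu (minn k s).
  elim: s => [|s IH]; first by rewrite minn0 !psum0.
  rewrite psumS IH /trunc; case: ltnP => ks.
    have -> : minn k s.+1 = s.+1 by lia.
    by rewrite psumS.
  have -> : minn k s.+1 = k by lia.
  by rewrite addn0.
rewrite !psum_trunc; have [ri|ir] := ltnP r i.+1.
  have e k : r <= k -> minn k r = r by move=> ?; apply/minn_idPr.
  have -> : minn i.+2 r.+1 = r.+1 by lia.
  have -> : minn i.+1 r.+1 = r.+1 by lia.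
  by rewrite (e i) // (e i.+1) // ltnW.
have -> : minn i.+1 r.+1 = i.+1 by lia.
have -> : minn i r = i by lia.
have [->|->] : minn i.+2 r.+1 = i.+1 \/ minn i.+2 r.+1 = i.+2 by lia.
  by rewrite !psumS; lia.
by rewrite !psumS; have := nm i; lia.
Qed.

(** Step [i] cannot reach below row [i], because the strips are horizontal and start from the empty
    partition. It adds nothing above row [i] either: the Yamanouchi inequality bounds the cells that
    step [i.+1] adds before row [i.+1] by those that step [i] adds before row [i]. *)
Lemma yamanouchi_from0 (A : chain) : hchain A -> yamanouchi A -> A 0 = rows0 ->
  forall i q, q != i -> A i.+1 q = A i q.
Proof.
move=> hA yA A0.
have z i q : i <= q -> A i q = 0.
  elim: i q => [|i IH] q; first by rewrite A0.
  by case: q => // q iq; move: (hA i q); rewrite IH //; lia.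
have s i : psum (A i.+1) i = psum (A i) i.
  elim: i => [|i IH]; first by rewrite !psum0.
  have := yA i i; rewrite IH leq_add2r => le.
  apply/eqP; rewrite eqn_leq le /= /psum; apply: leq_sum => q _.
  by case/andP: (hA i.+1 q).
have eqp f g n : (forall q, f q <= g q) -> psum g n = psum f n ->
    forall q, q < n -> g q = f q.
  move=> fg; elim: n => // n IH; rewrite !psumS => e.
  have le : psum f n <= psum g n by apply: leq_sum => q _.
  move: (fg n) => fgn q; rewrite ltnS leq_eqVlt => /predU1P[->|]; first lia.
  by apply: IH; lia.
move=> i q; rewrite neq_ltn => /orP[qi|iq]; last by rewrite !z // ltnW.
by apply: (eqp _ _ i) => // q'; case/andP: (hA i q').
Qed.

(* The row of the hole, after it has passed the entries up to [j], when it starts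
   in row [r] and has already passed the entries up to [v]. *)
Fixpoint hole_row (M : chain) v r j :=
  if j is j'.+1 then
    if j' < v then r
    else let p := hole_row M v r j' in p + (M j p.+1 == M j' p)
  else r.

(** The hole counts as a cell of [M] with entry [v]. When it has passed the entries up to [j], it is
    the last cell of its row in [M j], and deleting it gives the shape after the slide. *)
Definition slide (M : chain) v r : chain :=
  fun j q => M j q - ((v <= j) && (q == hole_row M v r j)).

Section SlideSwitch.

Variables (M : chain) (X : rows) (r : nat).
Hypotheses (hM : hchain M) (hX : hstrip X (M 0)).
Hypotheses (Xr : forall q, q < r -> X q = M 0 q) (ltXr : X r < M 0 r).

Let hr := hole_row M 0 r.
Let W := bkc M X.

(** The invariant behind the comparison: the hole remains the rightmost cell of the strip from [W j]
    to [M j]. The two cases of [hole_row] are [bk_min_cellS] and [bk_min_cell]. *)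
Lemma hole_corner j :
  (forall q, q < hr j -> W j q = M j q) /\ W j (hr j) < M j (hr j).
Proof.
rewrite /hr /W; elim: j => //= j [IH1 IH2].
have hs := bkc_hstrip hM hX j.
have [e|ne] := eqVneq (M j.+1 (hole_row M 0 r j).+1) (M j (hole_row M 0 r j)).
  rewrite addn1; have [e1 e2] := bk_min_cellS hs (hM j) IH1 IH2 e.
  by split=> // q; rewrite ltnS; apply: e1.
rewrite addn0; apply: bk_min_cell => //.
by move: ne (hM j (hole_row M 0 r j)); lia.
Qed.

Lemma slide_hchain : hchain (slide M 0 r).
Proof.
move=> j q; rewrite /slide /= -/(hr j).
have [c1 c2] := hole_corner j; have hs := bkc_hstrip hM hX j (hr j).
move: (hM j q) (hM j (hr j)) (hM j (hr j).+1).
have [e|ne] := eqVneq (M j.+1 (hr j).+1) (M j (hr j)).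
  rewrite addn1; case: (eqVneq q (hr j)) => [->|]; rewrite ?eqSS ?eqxx.
    by rewrite -/W in hs c2 *; case: eqP; lia.
  case: (eqVneq q (hr j).+1) => [->|]; last by lia.
  by rewrite -/W in hs c2 *; case: eqP; lia.
rewrite addn0; case: (eqVneq q (hr j)) => [->|]; first by case: eqP; lia.
by case: (eqVneq q.+1 (hr j)) => [<-|]; lia.
Qed.

(* The slide into the rightmost cell of a strip is one step of the switching of the
   whole strip. *)
Lemma slide_bkc : bkc (slide M 0 r) X = bkc M X.
Proof.
apply: funext => j; elim: j => //= j ->; rewrite -/(W j).
have [c1 c2] := hole_corner j; have hs := bkc_hstrip hM hX j; rewrite -/W in hs.
apply: funext => q; rewrite /slide /= -/(hr j) /bk.
move: c2 (hs (hr j)) (hM j (hr j)) (hM j (hr j).+1) (hs q) (hM j q).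
have [e|ne] := eqVneq (M j.+1 (hr j).+1) (M j (hr j)).
  move: e; rewrite addn1; case: q => [|q].
    by case: (eqVneq 0 (hr j)) => [<-|] /=; rewrite ?eqSS; lia.
  rewrite !eqSS; move: (hs q) (hM j q).
  case: (eqVneq q.+1 (hr j)) => [<-|].
    by rewrite (_ : (q == q.+1) = false); lia.
  case: (eqVneq q (hr j)) => [->|]; last by lia.
  by rewrite (_ : ((hr j).+1 == hr j) = false); lia.
move: ne; rewrite addn0; case: q => [|q].
  case: (eqVneq 0 (hr j)) => [<-|n0]; first by case: eqP; lia.
  case: (eqVneq 1 (hr j)) => [e1|]; last by lia.
  by have := c1 0; rewrite -e1 => /(_ isT); lia.
move: (hs q) (hM j q).
case: (eqVneq q.+1 (hr j)) => [e1|n1].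
  by have := c1 q; rewrite -e1 => /(_ (leqnn _)); case: eqP; lia.
case: (eqVneq q.+2 (hr j)) => [e2|]; last by lia.
by have := c1 q.+1; rewrite -e2 => /(_ (leqnn _)); lia.
Qed.

End SlideSwitch.

Lemma psum_le f g n : (forall q, f q <= g q) -> psum f n <= psum g n.
Proof. by move=> fg; apply: leq_sum. Qed.

Lemma leq_psum f q n : q < n -> f q <= psum f n.
Proof.
elim: n => // n IH; rewrite ltnS leq_eqVlt psumS => /predU1P[->|/IH]; lia.
Qed.

Lemma eq_psum f g n : (forall q, q < n -> f q = g q) -> psum f n = psum g n.
Proof. by move=> fg; apply: eq_big_nat => q /andP[_ /fg]. Qed.

Lemma eq_psum_at f g i n : i < n -> (forall q, q != i -> f q = g q) ->
  psum f n = psum g n -> f i = g i.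
Proof.
move=> i_n fg.
have s k : psum f k + (if i < k then g i else 0) =
    psum g k + (if i < k then f i else 0).
  elim: k => [|k IH]; first by rewrite !psum0.
  rewrite !psumS ltnS; have [e|ne] := eqVneq k i.
    by move: IH; rewrite e ltnn leqnn; lia.
  by rewrite fg // leq_eqVlt eq_sym (negPf ne) /=; lia.
by have := s n; rewrite i_n; lia.
Qed.

Lemma hstrip_le f g : hstrip f g -> forall q, f q <= g q.
Proof. by move=> h q; case/andP: (h q). Qed.

Lemma hchain_le M i j : hchain M -> i <= j -> forall q, M i q <= M j q.
Proof.
move=> hM /subnK <- q; elim: (j - i) => // d IH.
exact: leq_trans IH (hstrip_le (hM _) q).
Qed.

Section GridSize.

Variables (l m L : nat) (a M : chain).
Hypotheses (hM : hchain M) (ha : hchain a) (sM : stable m M) (sa : stable l a).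
Hypothesis aM : a l = M 0.
Hypothesis M0 : forall q, L <= q -> M m q = 0.

Let G := grid l a M.

Lemma grid_le i j q : G i j q <= M m q.
Proof.
have le1 : G i j q <= M j q.
  have [li|/ltnW il] := leqP l i; first by rewrite /G grid_top.
  rewrite -[in leqRHS](@grid_top l a M l) //.
  apply: (@hchain_le (fun i => G i j)) => // i'; exact: (grid_vstrip hM ha sa aM).
apply: leq_trans le1 _; have [mj|/ltnW jm] := leqP m j; first by rewrite sM.
exact: hchain_le.
Qed.

Lemma grid_size i j : psum (G i j.+1) L + psum (G i.+1 j) L =
  psum (G i.+1 j.+1) L + psum (G i j) L.
Proof.
have z i' j' q : L <= q -> G i' j' q = 0.
  by move=> Lq; apply/eqP; rewrite -leqn0 -(M0 Lq) grid_le.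
have := local_rule_psum hM ha sa aM L i j.
by rewrite -/G !psumS !z //; lia.
Qed.

Lemma grid_size0 i j : psum (G i.+1 j) L + psum (a i) L =
  psum (G i j) L + psum (a i.+1) L.
Proof.
elim: j => [|j IH]; first by rewrite /G !(grid_col0 sa aM) addnC.
by have := grid_size i j; lia.
Qed.

End GridSize.

(** * Finite lists of partitions and of chains *)

Section Boxed.

Variable L : nat.

(* The partitions of size less than [L], a bound for all the sizes that occur. *)
Definition box : seq rows :=
  undup [seq f <- [seq nth 0 s | s <- short_words L L]
           | `[<noninc f>] && (psum f L < L)].

Lemma box_uniq : uniq box. Proof. exact: undup_uniq. Qed.

(** A cell in row [L.-1] would give [L] nonempty rows. The sharp bound [L.-1] is what trivializes
    the boundary factor in [count_up_down]. *)
Lemma boxed_eq0 f : noninc f -> psum f L < L -> forall q, L.-1 <= q -> f q = 0.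
Proof.
move=> nf sf q Lq; apply/eqP; rewrite -leqn0.
apply: leq_trans (noninc_le nf Lq) _; rewrite leqNgt; apply/negP => pos.
have : L <= psum f L.
  have n1 n : n <= L -> n <= psum f n.
    elim: n => // n IH nL; rewrite psumS.
    have : 0 < f n by apply: leq_trans pos (noninc_le nf _); lia.
    by have := IH (ltnW nL); lia.
  exact: n1.
lia.
Qed.

Lemma mem_box f : (f \in box) <-> noninc f /\ psum f L < L.
Proof.
rewrite mem_undup mem_filter; split; first by case/andP=> /andP[/asboolP].
case=> nf sf; rewrite sf andbT asboolT //=; apply/mapP.
exists (mkseq f L); last first.
  apply: funext => q; have [qL|Lq] := ltnP q L; first by rewrite nth_mkseq.
  rewrite nth_default ?size_mkseq // (boxed_eq0 nf sf) //.
  exact: leq_trans (leq_pred _) Lq.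
apply: mem_short_words; first by rewrite size_mkseq.
apply/allP => x /mapP[q]; rewrite mem_iota => qL ->.
exact: leq_trans (leq_psum _ qL) (ltnW sf).
Qed.

Lemma box_eq0 f q : f \in box -> L <= q -> f q = 0.
Proof.
case/mem_box=> nf sf Lq; apply: boxed_eq0 => //.
exact: leq_trans (leq_pred _) Lq.
Qed.

Definition hups mu a :=
  [seq la <- box | `[<hstrip mu la>] && (psum la L == psum mu L + a)].

Definition pcons (mu : rows) (M : chain) : chain :=
  fun j => if j is j'.+1 then M j' else mu.

Fixpoint chains mu al : seq chain :=
  if al is a :: al' then [seq pcons mu M | la <- hups mu a, M <- chains la al']
  else [:: fun=> mu].

Lemma mem_hups mu a la : la \in hups mu a <->
  [/\ hstrip mu la, psum la L = psum mu L + a & psum la L < L].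
Proof.
rewrite mem_filter; split.
  by case/andP=> /andP[/asboolP ? /eqP ?] /mem_box[].
case=> h s sL; rewrite asboolT // s eqxx /=; apply/mem_box; split=> //.
by case: (hstrip_noninc h).
Qed.

Definition is_chain mu al (M : chain) :=
  [/\ M 0 = mu, hchain M, stable (size al) M,
      forall j, j < size al -> psum (M j.+1) L = psum (M j) L + nth 0 al j
    & psum (M (size al)) L < L].

Lemma chainsP mu al M : mu \in box -> (M \in chains mu al) <-> is_chain mu al M.
Proof.
elim: al mu M => [|a al IH] mu M mub /=.
  have /mem_box[nm sm] := mub; rewrite inE; split=> [/eqP->|[M0 _ sM _ _]].
    by split=> // j; apply: hstrip_refl.
  by apply/eqP/funext => j; rewrite sM // M0.
split.
  case/allpairsPdep => la [N [/mem_hups[h s sL]]].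
  have lab : la \in box by apply/mem_box; case: (hstrip_noninc h).
  case/(IH _ _ lab) => N0 hN sN cN lN ->; split=> //.
  - by case=> [|j] /=; rewrite ?N0.
  - by case=> // j; rewrite /= ltnS; apply: sN.
  by case=> [|j] /=; rewrite ?N0 // ltnS; apply: cN.
case=> M0 hM sM cM lM; apply/allpairsPdep.
exists (M 1), (fun j => M j.+1); split.
- apply/mem_hups; split; [by rewrite -M0|by rewrite (cM 0) // M0|].
  by apply: leq_ltn_trans lM; apply: psum_le; apply: hchain_le.
- apply/IH; first apply/mem_box.
    split; first by case: (hstrip_noninc (hM 0)).
    by apply: leq_ltn_trans lM; apply: psum_le; apply: hchain_le.
  split=> //; first by move=> j ?; apply: sM.
  by move=> j; apply: (cM j.+1).
- by apply: funext; case.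
Qed.

Lemma chains_uniq mu al : mu \in box -> uniq (chains mu al).
Proof.
elim: al mu => //= a al IH mu mub.
have hb la : la \in hups mu a -> la \in box.
  by rewrite mem_filter => /andP[].
apply: allpairs_uniq_dep.
- exact: filter_uniq box_uniq.
- by move=> la /hb; apply: IH.
move=> p q /allpairsPdep[la [N [/hb lab /(chainsP _ _ lab)[N0 _ _ _ _] ->]]].
move=> /allpairsPdep[la' [N' [/hb lab' /(chainsP _ _ lab')[N0' _ _ _ _] ->]]].
move=> /= e; have eN : N = N'.
  by apply: funext => j; have := congr1 (fun M : chain => M j.+1) e.
by rewrite -N0 -N0' eN.
Qed.

Lemma chain_box mu al M j : is_chain mu al M -> M j \in box.
Proof.
case=> _ hM sM _ lM; apply/mem_box; split.
  by case: (hstrip_noninc (hM j)).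
apply: leq_ltn_trans lM; have [le|/ltnW le] := leqP (size al) j.
  by rewrite sM.
by apply: psum_le; apply: hchain_le.
Qed.

(** Padded with zeros to length [L], [mu] becomes the content of its superstandard tableau, seen as
    a chain with [L] steps. *)
Definition parts (mu : rows) := mkseq mu L.

(* Switching past the superstandard tableau of shape [mu], from its last row up;
   [Rect] proceeds in this order, because it starts with the lowest corner. *)
Definition rect mu (M : chain) : chain := grid L (trunc^~ mu) M 0.

Lemma trunc_stable mu : mu \in box -> stable L (trunc^~ mu).
Proof.
move=> mub j Lj; apply: funext => q; rewrite /trunc.
case: (ltnP q L) => Lq; first by rewrite (leq_trans Lq Lj).
by rewrite (box_eq0 mub Lq); case: ifP.
Qed.

Lemma trunc_full mu : mu \in box -> trunc L mu = mu.
Proof.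
move=> mub; apply: funext => q; rewrite /trunc; case: ltnP => // Lq.
by rewrite (box_eq0 mub Lq).
Qed.

Lemma psum_truncS mu i : i < L ->
  psum (trunc i.+1 mu) L = psum (trunc i mu) L + mu i.
Proof.
move=> iL; have s n : psum (trunc i.+1 mu) n =
    psum (trunc i mu) n + (if i < n then mu i else 0).
  elim: n => [|n IH]; first by rewrite !psum0.
  rewrite !psumS IH /trunc !ltnS.
  by case: (ltngtP n i) => [?|?|->]; lia.
by rewrite s iL.
Qed.

Lemma trunc_unique mu (A : chain) : mu \in box -> A 0 = rows0 -> stable L A ->
    (forall i q, q != i -> A i.+1 q = A i q) ->
    (forall i, i < L -> psum (A i.+1) L = psum (A i) L + mu i) ->
  A = trunc^~ mu.
Proof.
move=> mub A0 sA nA kA.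
have AL i : i <= L -> A i = trunc i mu.
  elim: i => [_|i IH iL]; first by rewrite A0.
  have := kA _ iL; rewrite IH 1?ltnW // -psum_truncS // => e.
  have nqi q : q != i -> A i.+1 q = trunc i.+1 mu q.
    move=> qi; rewrite nA // IH 1?ltnW // /trunc ltnS.
    by move: qi; case: (ltngtP q i).
  apply: funext => q; have [->|/nqi//] := eqVneq q i.
  exact: eq_psum_at e.
apply: funext => i; have [iL|/ltnW Li] := leqP i L; first exact: AL.
by rewrite (trunc_stable mub Li) -AL // sA.
Qed.

(** * Rectification and its record as a bijection *)

Section RectSwitch.

Variables (mu : rows) (al : seq nat).
Hypothesis mub : mu \in box.

Let m := size al.
Let nm : noninc mu. Proof. by case/mem_box: mub. Qed.
Let ht : hchain (trunc^~ mu). Proof. by move=> i; apply: trunc_hstrip. Qed.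
Let st := trunc_stable mub.

(** What the superstandard tableau has become after the switching: the chain leads from the outer
    shape of the rectification to the outer shape of [M]. *)
Definition recording (M : chain) : chain :=
  fun i => grid L (trunc^~ mu) M i (size al).

Lemma recording_chain M : is_chain mu al M ->
  is_chain (rect mu M m) (parts mu) (recording M) /\ yamanouchi (recording M).
Proof.
case=> M0 hM sM cM lM; have aM : trunc L mu = M 0 by rewrite trunc_full.
have Mz q : L <= q -> M m q = 0 by apply: box_eq0; apply: (@chain_box mu al).
split.
  split=> //.
  - by move=> i; apply: (grid_vstrip hM ht st aM).
  - by rewrite size_mkseq => i Li; rewrite /recording !grid_top.
  - rewrite size_mkseq => i iL; rewrite nth_mkseq //.
    have := grid_size0 hM ht sM st aM Mz i (size al).
    by rewrite psum_truncS // /recording; lia.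
  - by rewrite size_mkseq /recording grid_top.
(* Column 0 is the superstandard tableau, and [yam3_slide] carries the condition from each column to
   the next. *)
rewrite /recording -/m; elim: m => [|j IH] i.
  by rewrite !(grid_col0 st aM); apply: trunc_yamanouchi.
apply: yam3_slide (IH i); try exact: (grid_vstrip hM ht st aM);
  try exact: (grid_hchain hM ht st aM); exact: (grid_local hM st aM).
Qed.

Section Inverse.

Variables (U A : chain).
Hypotheses (cU : is_chain rows0 al U).
Hypotheses (cA : is_chain (U m) (parts mu) A) (yA : yamanouchi A).

Definition unrect : chain := fun j => grid m U A j L.

(** The grid is rebuilt from [U] and [A], with the roles of rows and columns exchanged. Its row 0
    turns out to be the superstandard tableau, so [grid_transpose] identifies it with the grid that
    rectifies [unrect]. *)
Lemma unrectP :
  [/\ is_chain mu al unrect, rect mu unrect = U & recording unrect = A].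
Proof.
have [U0 hU sU kU lU] := cU; have [A0 hA sA kA lA] := cA.
rewrite size_mkseq in sA kA lA.
have aM : U m = A 0 by [].
have Az q : L <= q -> A L q = 0.
  apply: box_eq0; have := @chain_box _ _ _ L cA; exact.
set H := grid m U A.
have yH j : yamanouchi (fun i => H j i).
  elim/(@down_ind m): j => [j mj|j jm IH]; first by rewrite /H grid_top.
  move=> i; apply: yam3_unslide (IH i); try exact: (grid_vstrip hA hU sU aM);
    try exact: (grid_hchain hA hU sU aM).
  - rewrite [H j i.+1](grid_local hA sU aM) bk_invol //.
      exact: (grid_vstrip hA hU sU aM).
    exact: (grid_hchain hA hU sU aM).
  - rewrite [H j i.+2](grid_local hA sU aM) bk_invol //.
      exact: (grid_vstrip hA hU sU aM).
    exact: (grid_hchain hA hU sU aM).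
have sH j i : i < L -> psum (H j i.+1) L = psum (H j i) L + mu i.
  move=> iL; elim/(@down_ind m): j => [j mj|j jm IH].
    by rewrite /H grid_top // kA // nth_mkseq.
  by have := grid_size hA hU sA sU aM Az j i; rewrite -/H; lia.
(* Row 0 is Yamanouchi and starts from the empty partition, so step [i] changes row [i] alone, by
   [mu i] cells. *)
have H0 : H 0 = trunc^~ mu.
  have nq := yamanouchi_from0 (grid_hchain hA hU sU aM 0) (yH 0).
  rewrite (grid_col0 sU aM) in nq; move/(_ U0) in nq; rewrite -/H in nq.
  apply: trunc_unique => //; first by rewrite /H (grid_col0 sU aM).
    exact: (grid_stable hA hU sA sU aM).
  by move=> i; apply: sH.
have S0 : unrect 0 = mu by rewrite /unrect -/H H0 trunc_full.
have hS : hchain unrect by move=> j; apply: (grid_vstrip hA hU sU aM).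
have tr i j : grid L (H 0) unrect i j = H j i.
  exact: (grid_transpose hA hU sA sU aM).
have cS : is_chain mu al unrect.
  split=> //.
  - by move=> j mj; rewrite /unrect !grid_top.
  - move=> j jm; have := grid_size0 hA hU sA sU aM Az j L.
    by rewrite kU // /unrect -/m -/H; lia.
  - by rewrite /unrect grid_top.
rewrite H0 in tr; split=> //.
  apply: funext => j; rewrite /rect tr.
  by rewrite /H (grid_col0 sU aM).
by apply: funext => i; rewrite /recording tr /H grid_top.
Qed.

End Inverse.

End RectSwitch.

End Boxed.

(** * Pieri's rule and the Littlewood-Richardson rule *)

Section Sums.

Variable L : nat.
Notation box := (box L).
Notation chains := (chains L).
Notation is_chain := (is_chain L).

Lemma rows0_box : 0 < L -> rows0 \in box.
Proof. by move=> L0; apply/mem_box; split=> //; rewrite /psum big1. Qed.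

Lemma rect_chain mu al S : 0 < L -> mu \in box -> is_chain mu al S ->
  is_chain rows0 al (rect L mu S).
Proof.
move=> L0 mub cS; have [S0 hS sS kS lS] := cS.
have ht : hchain (trunc^~ mu).
  by move=> i; apply: trunc_hstrip; case/mem_box: mub.
have st := trunc_stable mub.
have aS : trunc L mu = S 0 by rewrite trunc_full.
have Sz q : L <= q -> S (size al) q = 0 by apply: box_eq0 (chain_box _ cS).
split.
- exact: (grid_col0 st aS).
- exact: (grid_hchain hS ht st aS).
- exact: (grid_stable hS ht sS st aS).
- move=> j jm; suff k i : psum (grid L (trunc^~ mu) S i j.+1) L =
      psum (grid L (trunc^~ mu) S i j) L + nth 0 al j by exact: k.
  move: i; elim/(@down_ind L) => [i Li|i iL IH]; first by rewrite !grid_top // kS.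
  by have := grid_size hS ht sS st aS Sz i j; lia.
- apply: leq_ltn_trans lS; apply: psum_le => q.
  exact: (grid_le hS ht sS st aS).
Qed.

(** The bijection is [recording], injective by [grid_transpose] and surjective by [unrectP]. The
    point is that the right-hand side depends on [U] only through its outer shape. *)
Lemma sum_rect (V : nmodType) mu al U (f : rows -> V) :
    0 < L -> mu \in box -> is_chain rows0 al U ->
  (\sum_(S <- chains mu al | rect L mu S == U) f (S (size al)) =
   \sum_(A <- chains (U (size al)) (parts L mu) | `[<yamanouchi A>]) f (A L))%R.
Proof.
move=> L0 mub cU; rewrite -big_filter -[RHS]big_filter.
have Ub := chain_box (size al) cU.
rewrite [RHS](perm_big (map (recording L mu al)
  [seq S <- chains mu al | rect L mu S == U])).
  rewrite big_map !big_filter; apply: eq_bigr => S _.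
  by rewrite /recording grid_top.
rewrite perm_sym; apply: uniq_perm.
- rewrite map_inj_in_uniq; first by rewrite filter_uniq // chains_uniq.
  move=> S T; rewrite !mem_filter => /andP[/eqP rS /(chainsP _ _ mub) cS].
  case/andP=> /eqP rT /(chainsP _ _ mub) cT e.
  have ht : hchain (trunc^~ mu).
    by move=> i; apply: trunc_hstrip; case/mem_box: mub.
  have st := trunc_stable mub.
  have rec M : is_chain mu al M -> rect L mu M = U ->
      grid (size al) U (recording L mu al M) ^~ L = M.
    case=> M0 hM sM _ _ rM; apply: funext => j.
    have aM : trunc L mu = M 0 by rewrite trunc_full.
    rewrite -rM (grid_transpose hM ht sM st aM).
    by rewrite grid_top.
  by rewrite -(rec S) // -[RHS](rec T) // e.
- by rewrite filter_uniq // chains_uniq.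
move=> A; rewrite mem_filter; apply/mapP/andP.
  case=> S; rewrite mem_filter => /andP[/eqP rS /(chainsP _ _ mub) cS] ->.
  have [cA yA] := recording_chain mub cS.
  by split; [rewrite asboolT | apply/chainsP => //; rewrite -rS].
case=> /asboolP yA /(chainsP _ _ Ub) cA.
have [cS rS eA] := unrectP mub cU cA yA.
exists (unrect L al U A) => //; rewrite mem_filter rS eqxx /=.
exact/chainsP.
Qed.

Lemma big_pick (V : nmodType) (I : eqType) (r : seq I) (i : I) (F : I -> V) :
  uniq r -> i \in r -> (\sum_(j <- r | i == j) F j = F i)%R.
Proof.
move=> ur ir; rewrite (eq_bigl (pred1 i)); last by move=> j; rewrite eq_sym.
by rewrite -big_filter filter_pred1_uniq // big_seq1.
Qed.

Lemma sum_rect_all (V : nmodType) mu al (F : chain -> V) :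
  0 < L -> mu \in box ->
  (\sum_(U <- chains rows0 al) \sum_(S <- chains mu al | rect L mu S == U) F S
   = \sum_(S <- chains mu al) F S)%R.
Proof.
move=> L0 mub; rewrite (exchange_big_dep xpredT) //= big_seq [RHS]big_seq.
apply: eq_bigr => S /(chainsP _ _ mub) cS; rewrite big_pick //.
  exact/chains_uniq/rows0_box.
by apply/chainsP; [apply: rows0_box | apply: rect_chain].
Qed.

Definition vstrip (f g : rows) := forall i, f i <= g i <= (f i).+1.

(** * Commutation of horizontal and vertical strips *)

Section LocalCount.

Variables mu rho : rows.
Hypotheses (mub : mu \in box) (rhob : rho \in box).

Local Open Scope ring_scope.

(* For a cell count [b] of 0 or 1, [ups i b] allows row [i] of [rho] to grow by [b]
   when passing to a partition [la] with [la / mu] a horizontal strip, and [downs]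
   is the dual condition on the rows of [mu]. *)
Definition ups i b :=
  (mu i <= rho i + b)%N && (if i is i'.+1 then rho i + b <= mu i' else true)%N.

Definition downs i d :=
  (rho i.+1 + d <= mu i)%N && (mu i <= rho i + d)%N.

Definition gen2 (P : nat -> bool) : {poly int} :=
  \sum_(b : bool) (P b)%:R * 'X^b.

(** The conditional factor is the upper bound in [ups n], split off from its lower bound; row 0 has
    no upper bound, whence [1 + 'X]. Passing from [n] to [n.+1] exchanges [ups n] for [downs n] and
    moves this factor one row down. *)
Lemma local_gen n :
  \prod_(i < n) gen2 (ups i) *
    (if n is n'.+1 then gen2 (fun b => rho n + b <= mu n')%N else 1 + 'X) =
  (1 + 'X) * \prod_(i < n) gen2 (downs i).
Proof.
case/mem_box: (mub) => nm _; case/mem_box: (rhob) => nr _.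
elim: n => [|n IH]; first by rewrite !big_ord0 mul1r mulr1.
rewrite !big_ord_recr /= [in RHS]mulrA -{}IH -!mulrA; congr (_ * _).
rewrite /gen2 !big_bool /ups /downs /= !addn0 !addn1 expr0 expr1.
(* These clauses exclude the impossible combinations of the comparisons; [ring] settles each
   remaining one. *)
have hs : [|| mu n <= rho n, ~~ (mu n <= (rho n).+1) | rho n.+1 < mu n]%N.
  by move: (nr n); lia.
have hp : ((mu n <= rho n) ==> (mu n <= (rho n).+1))%N by lia.
have hs' : ((rho n.+1 < mu n) ==> (rho n.+1 <= mu n))%N by lia.
case: n hs hp hs' => [|n] hs hp hs'; rewrite ?big_bool ?expr0 ?expr1 ?addn0 ?addn1 /=.
  move: hs hp hs'; rewrite ?andbT; case: (mu 0 <= rho 0)%N; case: (mu 0 <= _.+1)%N;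
    case: (rho 1 < mu 0)%N; case: (rho 1 <= mu 0)%N => //= _ _ _; ring.
have hq : [|| mu n.+1 <= rho n.+1, ~~ (mu n.+1 <= (rho n.+1).+1)
  | rho n.+1 < mu n]%N.
  by move: (nm n); lia.
have hq' : ((rho n.+1 < mu n) ==> (rho n.+1 <= mu n))%N by lia.
move: hs hp hs' hq hq'; case: (mu n.+1 <= rho n.+1)%N;
  case: (mu n.+1 <= _.+1)%N; case: (rho n.+2 < mu n.+1)%N;
  case: (rho n.+2 <= mu n.+1)%N; case: (rho n.+1 < mu n)%N;
  case: (rho n.+1 <= mu n)%N => //= _ _ _ _ _; ring.
Qed.

Lemma coef_gen2_prod (P : nat -> nat -> bool) j :
  (\prod_(i < L) gen2 (P i))`_j =
  #|[pred b : {ffun 'I_L -> bool} |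
      [forall i : 'I_L, P i (b i)] && (\sum_i b i == j)%N]|%:R.
Proof.
rewrite bigA_distr_bigA /= coef_sum -sum1_card natr_sum [RHS]big_mkcond /=.
apply: eq_bigr => b _; rewrite big_split /= prodrXr -natr_prod.
rewrite mulr_natl coefMn coefXn inE.
case: forallP => [Pb|nP] /=.
  have -> : (\prod_(i < L) P i (b i))%N = 1%N by apply: big1 => i _; rewrite Pb.
  by rewrite eq_sym mulr1n; case: eqP.
have [i /negP ni] : exists i : 'I_L, ~ P i (b i).
  by apply/not_existsP => h; apply: nP => i; apply: contrapT.
have -> : (\prod_(i < L) P i (b i))%N = 0%N.
  by rewrite (bigD1 i) //= (negbTE ni) mul0n.
by rewrite mulr0n.
Qed.

Local Open Scope nat_scope.

Definition bext (b : {ffun 'I_L -> bool}) i : nat :=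
  if insub i is Some k then b k else 0.

Lemma bextE b (k : 'I_L) : bext b k = b k.
Proof. by rewrite /bext valK. Qed.

Lemma bext_out b i : L <= i -> bext b i = 0.
Proof. by move=> Li; rewrite /bext insubF // ltnNge Li. Qed.

Lemma bext_le1 b i : bext b i <= 1.
Proof. by rewrite /bext; case: insub => // k; case: (b k). Qed.

Lemma psum_bext b : psum (bext b) L = \sum_i b i.
Proof. by rewrite /psum big_mkord; apply: eq_bigr => i _; rewrite bextE. Qed.

Lemma bext_inj b c : (forall i, i < L -> bext b i = bext c i) -> b = c.
Proof.
move=> e; apply/ffunP => i; have := e i (ltn_ord i).
by rewrite !bextE; case: (b i); case: (c i).
Qed.

Let nm : noninc mu. Proof. by case/mem_box: mub. Qed.
Let nr : noninc rho. Proof. by case/mem_box: rhob. Qed.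
Let mu0 q : L.-1 <= q -> mu q = 0.
Proof. by case/mem_box: mub => n s; apply: (boxed_eq0 n s). Qed.
Let rho0 q : L.-1 <= q -> rho q = 0.
Proof. by case/mem_box: rhob => n s; apply: (boxed_eq0 n s). Qed.

Definition count_up j := count (fun la => [&& `[<hstrip mu la>],
  `[<vstrip rho la>] & psum la L == psum rho L + j]) box.

Definition count_down j := count (fun ka => [&& `[<hstrip ka rho>],
  `[<vstrip ka mu>] & psum mu L == psum ka L + j]) box.

Lemma count_upE j : psum rho L + j < L -> count_up j =
  #|[pred b : {ffun 'I_L -> bool} |
      [forall i : 'I_L, ups i (b i)] && (\sum_i b i == j)]|.
Proof.
move=> jL; pose up b i := rho i + bext b i.
have psum_up b : psum (up b) L = psum rho L + \sum_i b i.
  by rewrite -psum_bext /psum -big_split.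
rewrite /count_up -size_filter cardE -(size_map up); apply/perm_size/uniq_perm.
- exact/filter_uniq/box_uniq.
- rewrite map_inj_uniq ?enum_uniq // => b c e; apply: bext_inj => i _.
  by apply: (@addnI (rho i)); apply: (congr1 (fun f : rows => f i) e).
move=> la; rewrite mem_filter; apply/idP/mapP.
  case/andP=> /and3P[/asboolP h /asboolP v /eqP s] /mem_box[nl ls].
  pose b := [ffun i : 'I_L => rho i < la i].
  have lab i : la i = up b i.
    rewrite /up; have [iL|Li] := ltnP i L.
      by rewrite (bextE b (Ordinal iL)) ffunE /=; move: (v i); case: ltnP; lia.
    rewrite bext_out // (boxed_eq0 nl ls) ?rho0 //; lia.
  have {}lab : la = up b by apply: funext.
  exists b => //; rewrite mem_enum inE; apply/andP; split.
    apply/forallP => i; rewrite -bextE /ups.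
    have /andP[_] := h i; rewrite lab => -> /=.
    case: (i : nat) => //= i'; have /andP[] := h i'.
    by rewrite {1}lab.
  by apply/eqP; have := psum_up b; rewrite -lab s; lia.
case=> b; rewrite mem_enum inE => /andP[/forallP ub /eqP sb] ->.
have u i : ups i (bext b i).
  have [iL|Li] := ltnP i L.
    by have := ub (Ordinal iL); rewrite -(bextE b (Ordinal iL)).
  have Li' : L.-1 <= i by lia.
  by rewrite /ups bext_out // mu0 // rho0 //; case: (i).
have h : hstrip mu (up b).
  by move=> q; apply/andP; split; [case/andP: (u q.+1)|case/andP: (u q)].
rewrite /= psum_up sb eqxx andbT !asboolT //=.
  apply/mem_box; split; first by case: (hstrip_noninc h).
  by rewrite psum_up sb.
by move=> i; rewrite /up; have := bext_le1 b i; lia.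
Qed.

Lemma count_downE j : count_down j =
  #|[pred b : {ffun 'I_L -> bool} |
      [forall i : 'I_L, downs i (b i)] && (\sum_i b i == j)]|.
Proof.
pose dn b i := mu i - bext b i.
have psum_dn b : (forall i, bext b i <= mu i) ->
    psum mu L = psum (dn b) L + \sum_i b i.
  move=> le; rewrite -psum_bext /psum -big_split /=.
  by apply: eq_bigr => i _; rewrite subnK.
have dP (b : {ffun 'I_L -> bool}) : [forall i : 'I_L, downs i (b i)] -> forall i, downs i (bext b i).
  move=> /forallP ub i; have [iL|Li] := ltnP i L.
    by have := ub (Ordinal iL); rewrite -(bextE b (Ordinal iL)).
  by rewrite /downs bext_out // mu0 ?rho0 //; lia.
have dle (b : {ffun 'I_L -> bool}) : (forall i, downs i (bext b i)) -> forall i, bext b i <= mu i.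
  by move=> u i; case/andP: (u i); lia.
rewrite /count_down -size_filter cardE -(size_map dn).
apply/perm_size/uniq_perm.
- exact/filter_uniq/box_uniq.
- rewrite map_inj_in_uniq ?enum_uniq // => b c.
  rewrite !mem_enum !inE => /andP[/dP/dle ub _] /andP[/dP/dle uc _] e.
  apply: bext_inj => i _; have := congr1 (fun f : rows => f i) e.
  by rewrite /dn; have := ub i; have := uc i; lia.
move=> ka; rewrite mem_filter; apply/idP/mapP.
  case/andP=> /and3P[/asboolP h /asboolP v /eqP s] /mem_box[nk ks].
  pose b := [ffun i : 'I_L => ka i < mu i].
  have bE i : bext b i = mu i - ka i.
    have [iL|Li] := ltnP i L.
      by rewrite (bextE b (Ordinal iL)) ffunE /=; move: (v i); case: ltnP; lia.
    by rewrite bext_out // (boxed_eq0 nk ks) ?mu0 //; lia.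
  have kab : ka = dn b.
    by apply: funext => i; rewrite /dn bE; move: (v i); lia.
  exists b => //; rewrite mem_enum inE; apply/andP; split.
    apply/forallP => i; rewrite -bextE /downs bE.
    by move: (h i) (v i); lia.
  have := psum_dn b; rewrite -kab s => e; apply/eqP.
  by apply: (@addnI (psum ka L)); rewrite -e // => i; rewrite bE leq_subr.
case=> b; rewrite mem_enum inE => /andP[/dP u /eqP sb] ->.
have h : hstrip (dn b) rho.
  by move=> i; move: (u i); rewrite /downs /dn; lia.
have v : vstrip (dn b) mu.
  by move=> i; move: (dle _ u i) (bext_le1 b i); rewrite /dn; lia.
rewrite !asboolT //= (psum_dn b) ?sb ?eqxx; last exact: dle.
apply/mem_box; split; first by case: (hstrip_noninc h).
case/mem_box: mub => _; apply: leq_ltn_trans; apply: psum_le => i.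
exact: leq_subr.
Qed.

(** Coefficient of ['X^j] in [local_gen L]; the two summands come from the factor [1 + 'X]. *)
Lemma count_up_down j : psum rho L + j < L ->
  count_up j = count_down j + (if j is j'.+1 then count_down j' else 0).
Proof.
move=> jL; have L0 : 0 < L by apply: leq_ltn_trans jL.
(* Row [L] of [rho] and row [L.-1] of [mu] are empty, so the boundary factor admits no cell. *)
have X1 : (if L is n'.+1 then gen2 (fun b => rho L + b <= mu n')%N
    else 1%R + 'X)%R = 1%R.
  rewrite -[L in if L is _.+1 then _ else _](prednK L0) mu0 // rho0 ?leq_pred //.
  by rewrite /gen2 big_bool /= ?mulr0n ?mulr1n mul0r mul1r add0r expr0.
have := congr1 (fun p : {poly int} => (p`_j)%R) (local_gen L).
rewrite X1 mulr1 mulrDl mul1r coefD coefXM !coef_gen2_prod -count_upE //.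
rewrite -count_downE; case: j jL {X1} => [|j] jL /=.
  by rewrite addr0 addn0 => /eqP; rewrite Num.Theory.eqr_nat => /eqP.
by rewrite -count_downE -natrD => /eqP; rewrite Num.Theory.eqr_nat => /eqP.
Qed.

End LocalCount.

Local Open Scope ring_scope.

(** * Conjugate Schur functions and Pieri's rule *)

Section Schur.

Variables (R : comNzRingType) (x : nat -> R).

(* The Schur function of the conjugate of [g] in [x 0], ..., [x n.-1]. *)
Fixpoint cschur n (g : rows) : R :=
  if n is n'.+1 then
    \sum_(f <- box | `[<vstrip f g>])
       x n' ^+ (psum g L - psum f L) * cschur n' f
  else (g == rows0)%:R.

Definition one_row a : rows := fun i => if i == 0%N then a else 0%N.

Lemma psum_row a : (0 < L)%N -> psum (one_row a) L = a.
Proof.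
by case: L => // l _; elim: l => [|l IH]; rewrite psumS ?psum0 ?add0n // IH addn0.
Qed.

Lemma row_box a : (a < L)%N -> one_row a \in box.
Proof.
move=> aL; apply/mem_box; split; first by case.
by rewrite psum_row //; apply: leq_ltn_trans aL.
Qed.

Lemma psum_eq0 f : f \in box -> psum f L = 0%N -> f = rows0.
Proof.
move=> fb f0; apply: funext => q; have [qL|Lq] := ltnP q L.
  by apply/eqP; rewrite -leqn0 -[leqRHS]f0 leq_psum.
by rewrite (box_eq0 fb Lq).
Qed.

Lemma psum_rows0 n : psum rows0 n = 0%N.
Proof. by rewrite /psum big1. Qed.

Lemma vstrip_row k a : k \in box -> (0 < L)%N ->
  vstrip k (one_row a) <-> k = one_row a \/ (0 < a)%N /\ k = one_row a.-1.
Proof.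
move=> kb L0; split=> [v|[->|[a0 ->]] [|i] /=]; rewrite ?leqnn ?leqnSn //;
  try by rewrite /one_row /= ?prednK ?leq_pred ?leqnn.
have k0 i : k i.+1 = 0%N by have := v i.+1; rewrite /one_row /=; lia.
have := v 0%N; rewrite /one_row /= => v0.
have [e|ne] := eqVneq (k 0%N) a; [left|right].
  by apply: funext => -[|i]; rewrite ?k0.
split; first by lia.
by apply: funext => -[|i]; rewrite ?k0 // /one_row /=; lia.
Qed.

(** The conjugate of one row is one column, so this is the recurrence of the elementary symmetric
    functions e_a in the number of variables. *)
Lemma cschur_rowS n a : (a < L)%N -> cschur n.+1 (one_row a) =
  cschur n (one_row a) + (if a is a'.+1 then x n * cschur n (one_row a') else 0).
Proof.
move=> aL; have L0 : (0 < L)%N by apply: leq_ltn_trans aL.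
rewrite /= -big_filter.
have P : perm_eq [seq f <- box | `[<vstrip f (one_row a)>]]
    (one_row a :: (if a is a'.+1 then [:: one_row a'] else [::])).
  apply: uniq_perm; first exact/filter_uniq/box_uniq.
    case: (a) => // a'; rewrite /= inE andbT; apply/eqP => /(congr1 (fun f : rows => f 0%N)).
    by rewrite /one_row /=; lia.
  move=> f; rewrite mem_filter inE; apply/andP/orP.
    case=> /asboolP v fb; case/(vstrip_row _ fb L0): v => [->|[a0 ->]].
      by left.
    by right; case: (a) a0 => // a' _; rewrite inE.
  have vb g : g = one_row a \/ (0 < a)%N /\ g = one_row a.-1 -> g \in box.
    by case=> [->|[_ ->]]; apply: row_box => //; apply: leq_ltn_trans (leq_pred _) aL.
  move=> h; have {}h : f = one_row a \/ (0 < a)%N /\ f = one_row a.-1.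
    case: h => [/eqP|]; first by left.
    by case: (a) => // a'; rewrite inE => /eqP; right.
  have fb := vb _ h; split=> //; apply/asboolP/vstrip_row => //.
rewrite (perm_big _ P) /= big_cons subnn expr0 mul1r; congr (_ + _).
case: a aL {P} => [|a] aL; first by rewrite big_nil.
by rewrite big_seq1 !psum_row // subSnn expr1.
Qed.

Lemma cschur_rows0 n : (0 < L)%N -> cschur n rows0 = 1.
Proof.
move=> L0; elim: n => [|n IH]; first by rewrite /= eqxx.
have -> : rows0 = one_row 0 by apply: funext; case.
rewrite cschur_rowS // addr0 -[RHS]IH; congr cschur.
by apply: funext; case.
Qed.

Lemma sum_const_seq (I : Type) (r : seq I) (P : pred I) (c : R) :
  \sum_(i <- r | P i) c = c *+ count P r.
Proof. by rewrite big_const_seq; elim: (count P r) => //= n ->; rewrite mulrS. Qed.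

(** Splitting off the variable [x n] turns both sides into combinations of the [cschur n rho]. Their
    coefficients agree by [count_up_down], whose two summands match the two terms of
    [cschur_rowS]. *)
Lemma pieri n mu a : mu \in box -> (psum mu L + a < L)%N ->
  cschur n mu * cschur n (one_row a) = \sum_(la <- hups L mu a) cschur n la.
Proof.
elim: n mu a => [|n IH] mu a mub sL; have L0 : (0 < L)%N by lia.
  have rb := rows0_box L0; have [/andP[/eqP mu0 /eqP a0]|ne] :=
      boolP ((mu == rows0) && (a == 0%N)).
    have r0 : one_row 0 = rows0 by apply: funext; case.
    rewrite mu0 a0 r0 (bigD1_seq rows0) /=; first last.
    - exact/filter_uniq/box_uniq.
    - apply/mem_hups; split; rewrite ?psum_rows0 //.
    by rewrite eqxx mulr1 big1 ?addr0 // => la /negPf ->; rewrite mulr0n.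
  rewrite big_seq big1 => [|la /mem_hups[h s _]]; last first.
    rewrite /=; have [la0|_] := eqVneq la rows0; last by rewrite mulr0n.
    case/negP: ne; move: s; rewrite la0 psum_rows0 => s.
    by rewrite (psum_eq0 mub) ?eqxx; lia.
  rewrite /=; have [mu0|_] := eqVneq mu rows0; last by rewrite mulr0n mul0r.
  move: ne; rewrite mu0 eqxx /=; have [e|] := eqVneq (one_row a) rows0; last by rewrite mulr0.
  by have := congr1 (fun f : rows => f 0%N) e; rewrite /one_row /= => ->.
have aL : (a < L)%N by lia.
(* [k] is [mu] without the cells that carry [x n], and [rho] is [k] plus a horizontal strip of [a]
   or [a - 1] cells. The second size is written with a successor, so that it contributes nothing for
   [a = 0]. *)
transitivity (\sum_(rho <- box) cschur n rho *
   \sum_(k <- box | `[<hstrip k rho>] && `[<vstrip k mu>])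
     x n ^+ (psum mu L - psum k L) * ((psum rho L == psum k L + a)%N%:R +
     x n * ((psum rho L).+1 == psum k L + a)%N%:R)).
  rewrite cschur_rowS // [cschur n.+1 mu]/= mulr_suml.
  under [RHS]eq_bigr do rewrite mulr_sumr.
  rewrite (exchange_big_dep (fun k => `[<vstrip k mu>])) /=; last first.
    by move=> ? ? _ /andP[].
  rewrite -!(big_filter box (fun k => `[<vstrip k mu>])) !big_seq.
  apply: eq_bigr => k; rewrite mem_filter => /andP[/asboolP v kb].
  have sk : (psum k L <= psum mu L)%N by apply: psum_le => i; case/andP: (v i).
  have ik b : (b <= a)%N -> cschur n k * cschur n (one_row b) =
      \sum_(rho <- box | `[<hstrip k rho>])
        cschur n rho * (psum rho L == psum k L + b)%N%:R.
    move=> ba; rewrite IH //; last by lia.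
    rewrite /hups big_filter big_mkcondr; apply: eq_bigr => rho _.
    by case: eqP; rewrite ?mulr1 ?mulr0.
  rewrite mulrDr -mulrA ik //.
  have -> : x n ^+ (psum mu L - psum k L) * cschur n k *
     (if a is a'.+1 then x n * cschur n (one_row a') else 0) =
     x n ^+ (psum mu L - psum k L) * (x n * \sum_(rho <- box | `[<hstrip k rho>])
        cschur n rho * ((psum rho L).+1 == psum k L + a)%N%:R).
    case: a aL sL ik => [|a] aL sL ik.
      rewrite mulr0 big1 ?mulr0 // => rho /asboolP h.
      have : (psum k L <= psum rho L)%N by apply/psum_le/hstrip_le.
      by case: eqP => [|_]; rewrite ?mulr0 //; lia.
    rewrite -mulrA [cschur n k * _]mulrCA ik //; congr (_ * (_ * _)).
    by apply: eq_bigr => rho _; rewrite addnS eqSS.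
  rewrite -mulrDr mulr_sumr -big_split mulr_sumr /=.
  apply: eq_big => [rho|rho _]; first by rewrite (asboolT v) andbT.
  by ring.
transitivity (\sum_(rho <- box) cschur n rho *
   \sum_(la <- hups L mu a | `[<vstrip rho la>])
     x n ^+ (psum la L - psum rho L)); last first.
  under eq_bigr do rewrite mulr_sumr.
  rewrite (exchange_big_dep xpredT) //=; apply: eq_bigr => la _.
  by apply: eq_bigr => rho _; rewrite mulrC.
rewrite !big_seq; apply: eq_bigr => rho rhob; congr (_ * _).
under eq_bigr do rewrite mulrDr.
rewrite big_split /=.
have cond (P Q : rows -> bool) (F : rows -> R) c :
    (forall k, k \in box -> P k -> Q k -> F k = c) ->
    \sum_(k <- box | P k) F k * (Q k)%:R = c *+ count (fun k => P k && Q k) box.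
  move=> Fc; rewrite -sum_const_seq big_seq_cond [RHS]big_mkcondr [RHS]big_seq_cond.
  apply: eq_bigr => k /andP[kb Pk].
  by case Qk: (Q k); rewrite ?mulr0 // mulr1 (Fc k).
have le_k k : `[<hstrip k rho>] && `[<vstrip k mu>] ->
    (psum k L <= psum rho L)%N /\ (psum k L <= psum mu L)%N.
  case/andP=> /asboolP h /asboolP v; split; first exact/psum_le/hstrip_le.
  by apply: psum_le => i; case/andP: (v i).
rewrite /hups big_filter_cond.
(* If [rho] has more than [psum mu L + a] cells, it is contained in no admissible [la], and both
   sides vanish. *)
have [rhoL|muL] := leqP (psum rho L) (psum mu L + a); last first.
  rewrite [RHS]big1 => [|la]; last first.
    case/andP=> /andP[_ /eqP s] /asboolP v.
    have : (psum rho L <= psum la L)%N by apply: psum_le => i; case/andP: (v i).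
    by lia.
  rewrite !big1 ?addr0 // => k hv; have [k1 k2] := le_k k hv.
    by case: eqP => [|_]; rewrite ?mulr0 ?mulr1 //; lia.
  by case: eqP => [|_]; rewrite ?mulr0 ?mulr1 //; lia.
(* [j] is the number of cells of la / rho, hence the exponent of [x n] in every term. *)
have [j ej] : exists j, (psum mu L + a = psum rho L + j)%N.
  by exists (psum mu L + a - psum rho L)%N; rewrite subnKC.
rewrite (cond _ _ _ (x n ^+ j)); last first.
  by move=> k _ _ /eqP e /=; congr (_ ^+ _); lia.
under [X in _ + X = _]eq_bigr do rewrite mulrA -exprSr.
rewrite (cond _ _ _ (x n ^+ j)); last first.
  by move=> k _ /le_k[_ km] /eqP e /=; congr (_ ^+ _); lia.
rewrite -mulrnDr.
transitivity (\sum_(la <- box | [&& `[<hstrip mu la>], `[<vstrip rho la>]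
    & psum la L == psum rho L + j]%N) x n ^+ j).
  rewrite sum_const_seq -/(count_up mu rho j) count_up_down //; last by lia.
  congr (_ *+ (_ + _)).
    apply: eq_in_count => k _; rewrite -andbA; congr (_ && (_ && _)).
    by apply/eqP/eqP; lia.
  case: j ej => [|j] ej.
    rewrite -[RHS](count_pred0 box); apply: eq_in_count => k _.
    apply/negbTE/negP => /andP[hv /eqP e]; have [_] := le_k k hv.
    by clear -e ej; lia.
  apply: eq_in_count => k _; rewrite -andbA; congr (_ && (_ && _)).
  by apply/eqP/eqP; lia.
apply: eq_big => la; last first.
  by case/and3P=> _ _ /eqP ->; rewrite addKn.
by rewrite ej [RHS]andbAC -andbA.
Qed.

Lemma sum_chains n mu al : mu \in box -> (psum mu L + sumn al < L)%N ->
  \sum_(S <- chains mu al) cschur n (S (size al)) =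
  cschur n mu * \prod_(a <- al) cschur n (one_row a).
Proof.
elim: al mu => [|a al IH] mu mub /= sL; first by rewrite big_seq1 big_nil mulr1.
rewrite big_allpairs_dep big_cons mulrA pieri //; last by lia.
rewrite mulr_suml big_seq [RHS]big_seq; apply: eq_bigr => la /mem_hups[h s sl].
rewrite /= IH //; last by rewrite s; lia.
by apply/mem_box; split=> //; case: (hstrip_noninc h).
Qed.

Lemma chain_size mu al M : is_chain mu al M ->
  psum (M (size al)) L = (psum mu L + sumn al)%N.
Proof.
case=> M0 _ _ kM _; rewrite -M0.
suff k j : (j <= size al)%N -> psum (M j) L = (psum (M 0) L + sumn (take j al))%N.
  by rewrite k // take_size.
elim: j => [|j IH] jm; first by rewrite take0 addn0.
by rewrite kM // IH 1?ltnW // (take_nth 0%N) // sumn_rcons addnA.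
Qed.

Lemma sumn_parts nu : sumn (parts L nu) = psum nu L.
Proof. by rewrite sumnE big_map /psum /index_iota subn0. Qed.

Lemma trunc_chain nu : nu \in box -> is_chain rows0 (parts L nu) (trunc^~ nu).
Proof.
move=> nub; split.
- by apply: funext.
- by move=> i; apply: trunc_hstrip; case/mem_box: nub.
- by rewrite size_mkseq; apply: trunc_stable.
- by rewrite size_mkseq => j jL; rewrite psum_truncS // nth_mkseq.
- by rewrite size_mkseq trunc_full //; case/mem_box: nub.
Qed.

(* Strictly decreasing for the dominance order. *)
Definition moment (f : rows) := (\sum_(0 <= q < L) q * f q)%N.

(* Entries of row [q] of a tableau are larger than [q]. *)
Lemma moment_chain nu U : nu \in box -> is_chain rows0 (parts L nu) U ->
  (moment (U L) <= moment nu)%N /\ (moment (U L) = moment nu -> U = trunc^~ nu).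
Proof.
move=> nub [U0 hU sU kU _]; rewrite size_mkseq in sU kU.
have z j q : (j <= q)%N -> U j q = 0%N.
  elim: j q => [|j IH] q; first by rewrite U0.
  by case: q => // q jq; move: (hU j q); rewrite IH //; lia.
pose d j q := (U j.+1 q - U j q)%N.
have dE j q : U j.+1 q = (U j q + d j q)%N.
  by rewrite subnKC //; case/andP: (hU j q).
have dsum j : (j < L)%N -> psum (d j) L = nu j.
  move=> jL; apply: (@addnI (psum (U j) L)).
  rewrite -[X in _ = (_ + X)%N](nth_mkseq 0%N nu jL) -kU //.
  by rewrite /psum -big_split; apply: eq_bigr => q _; rewrite dE.
pose w j := (\sum_(0 <= q < L) (j - q) * d j q)%N.
have step j : (j < L)%N -> (moment (U j.+1) + w j = moment (U j) + j * nu j)%N.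
  move=> jL; rewrite -(dsum _ jL) /moment /w /psum big_distrr /= -!big_split /=.
  apply: eq_bigr => q _; rewrite dE; have [qj|jq] := leqP q j.
    by rewrite mulnDr -addnA -mulnDl subnKC.
  by rewrite /d !z ?muln0 // ltnW.
have tot k : (k <= L)%N ->
    (moment (U k) + \sum_(0 <= j < k) w j = \sum_(0 <= j < k) j * nu j)%N.
  elim: k => [|k IH] kL.
    by rewrite !big_nil addn0 /moment big1 // => q _; rewrite U0 muln0.
  rewrite !big_nat_recr //= -IH 1?ltnW //; have := step k kL; lia.
have := tot L (leqnn _); rewrite -/(moment nu) => e; split; first by lia.
move=> me; have w0 j : (j < L)%N -> w j = 0%N.
  have : (\sum_(0 <= j < L) w j)%N = 0%N by lia.
  move/eqP; rewrite big_mkord sum_nat_eq0 => /forallP h jL.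
  by have /eqP := h (Ordinal jL).
apply: (trunc_unique nub U0 sU) => [i q qi|i iL]; last first.
  by rewrite kU // nth_mkseq.
have [iL|Li] := ltnP i L; last by rewrite !sU // leqW.
have [qlt|iq] := ltnP q i; last by rewrite !z // ltn_neqAle eq_sym qi.
rewrite dE; have /eqP := w0 _ iL; rewrite /w big_mkord sum_nat_eq0.
move=> /forallP/(_ (Ordinal (ltn_trans qlt iL))) /=.
by rewrite muln_eq0 subn_eq0 leqNgt qlt /= => /eqP ->; rewrite addn0.
Qed.

Lemma yamanouchi_sum n mu nu : mu \in box -> nu \in box ->
    (psum mu L + psum nu L < L)%N ->
  \sum_(A <- chains nu (parts L mu) | `[<yamanouchi A>]) cschur n (A L) =
  cschur n mu * cschur n nu.
Proof.
move=> mub; have [d] := ubnP (moment nu); elim: d nu => // d IH nu ltd nub sL.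
have L0 : (0 < L)%N by lia.
have tc := trunc_chain nub.
have rb := rows0_box L0.
(* Both parts of the difference have the same sum over [U]: Pieri's rule evaluates the second, and
   also the first once [sum_rect] has turned it into a sum over all chains from [mu], grouped by
   rectification. *)
have : \sum_(U <- chains rows0 (parts L nu))
    (\sum_(A <- chains (U L) (parts L mu) | `[<yamanouchi A>]) cschur n (A L) -
     cschur n mu * cschur n (U L)) = 0.
  rewrite sumrB -mulr_sumr; have := @sum_chains n rows0 (parts L nu) rb.
  rewrite sumn_parts psum_rows0 size_mkseq => -> //; last by lia.
  rewrite cschur_rows0 // mul1r -sum_chains // ?sumn_parts //; apply/eqP; rewrite subr_eq0.
  rewrite -(@sum_rect_all _ mu (parts L nu)) // size_mkseq.
  rewrite big_seq [X in _ == X]big_seq; apply/eqP/eq_bigr => U /(chainsP _ _ rb) cU.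
  have := sum_rect (cschur n) L0 mub cU.
  by rewrite !size_mkseq => ->.
rewrite (bigD1_seq (trunc^~ nu)) /=; first last.
- exact: chains_uniq.
- exact/chainsP.
rewrite trunc_full // [X in _ + X]big_seq_cond [X in _ + X]big1 ?addr0.
  by move/eqP; rewrite subr_eq0 => /eqP.
(* The outer shape of any other [U] has smaller moment, so its term vanishes by induction. *)
move=> U /andP[Uin neU]; have cU := (chainsP _ _ rb).1 Uin.
have [mle meq] := moment_chain nub cU.
apply/eqP; rewrite subr_eq0; apply/eqP/IH.
- rewrite -ltnS; apply: leq_trans (ltd); rewrite ltnS ltn_neqAle mle andbT.
  by apply: contra neU => /eqP/meq ->.
- exact: chain_box cU.
- have := chain_size cU; rewrite size_mkseq sumn_parts psum_rows0 => ->.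
  by rewrite add0n.
Qed.

Lemma sum_rect_mul n mu al U : mu \in box -> is_chain rows0 al U ->
    (psum mu L + sumn al < L)%N ->
  \sum_(S <- chains mu al | rect L mu S == U) cschur n (S (size al)) =
  cschur n mu * cschur n (U (size al)).
Proof.
move=> mub cU sL; have L0 : (0 < L)%N by lia.
rewrite (sum_rect (cschur n)) // yamanouchi_sum //; first exact: chain_box cU.
by rewrite (chain_size cU) psum_rows0 add0n.
Qed.

End Schur.

End Sums.

(** * Jeu de taquin on tableaux *)

Definition tab_chain (T : tableau) : chain :=
  fun j q => count (fun x => x <= j) (nth [::] T q).

Lemma ltn_count_sorted s c j : sorted leq s ->
  (c < count (fun x => x <= j) s) = (c < size s) && (nth 0 s c <= j).
Proof.
elim: s c => [|x s IH] c //= xs.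
have ss := path_sorted xs.
have [xj|jx] := leqP x j; first by case: c => [|c] //=; rewrite add1n !ltnS IH.
have -> : count (fun y => y <= j) s = 0.
  apply/eqP; rewrite -leqn0 leqNgt -has_count; apply/hasPn => y ys.
  rewrite -ltnNge; apply: leq_trans jx _.
  by move/(order_path_min leq_trans)/allP: xs; apply.
rewrite addn0 /=; apply/esym/negbTE/negP => /andP[cs].
case: c cs => [|c] cs /=; first by lia.
have : x <= nth 0 s c.
  by move/(order_path_min leq_trans)/allP: xs; apply; apply: mem_nth.
lia.
Qed.

Lemma count_le_take s c j : sorted leq s ->
  count (fun x => x <= j) (take c s) = minn c (count (fun x => x <= j) s).
Proof.
move=> ss; apply/eqP; rewrite eqn_leq.
have e i : (i < count (fun x => x <= j) (take c s)) =
    (i < minn c (count (fun x => x <= j) s)).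
  rewrite ltn_count_sorted ?take_sorted // leq_min ltn_count_sorted //.
  by rewrite size_take_min leq_min; case: ltnP => //= ic; rewrite nth_take.
apply/andP; split; rewrite leqNgt; apply/negP.
  by rewrite e ltnn.
by rewrite -e ltnn.
Qed.

Lemma count_set_nth_le s c y j : c < size s ->
  count (fun x => x <= j) (set_nth 0 s c y) + (nth 0 s c <= j) =
  count (fun x => x <= j) s + (y <= j).
Proof.
elim: s c => //= x s IH [|c] /= cs; first by lia.
by have := IH c cs; lia.
Qed.

Lemma sorted_set_nth s c y : sorted leq s -> c < size s -> nth 0 s c <= y ->
  (c.+1 < size s -> y <= nth 0 s c.+1) -> sorted leq (set_nth 0 s c y).
Proof.
move=> /(sortedP 0) h cs le ge; apply/(sortedP 0) => i.
rewrite size_set_nth (maxn_idPr cs) !nth_set_nth /= => iS.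
have [e1|n1] := eqVneq i c; have [e2|n2] := eqVneq i.+1 c; rewrite ?leqnn //.
- by rewrite e1 ge // -e1.
- apply: (leq_trans _ le); rewrite -e2.
  by apply: h; rewrite e2.
exact: h.
Qed.

Lemma nth_set_row T r w q : nth [::] (set_nth [::] T r w) q =
  if q == r then w else nth [::] T q :> seq nat.
Proof. exact: nth_set_nth. Qed.

Lemma sorted_rows T : all (sorted leq) T <-> forall q, sorted leq (nth [::] T q).
Proof.
split=> [/(all_nthP [::]) h q|h]; last exact/(all_nthP [::]).
by have [/h//|le] := ltnP q (size T); rewrite nth_default.
Qed.

Lemma hole_row_stay (M : chain) v r k : (forall j, v <= j < k -> M j.+1 r.+1 < M j r) ->
  forall j, j <= k -> hole_row M v r j = r.
Proof.
move=> h; elim=> //= j IH jk; case: ltnP => // vj.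
by rewrite IH 1?ltnW // [_ == _](_ : _ = false) ?addn0 //; move: (h j); lia.
Qed.

Section HoleStep.

Variables (M M1 : chain) (v y r : nat).
Hypothesis M1E : forall j q, M1 j q + ((q == r) && (v <= j)) =
  M j q + ((q == r) && (y <= j)).

(** The hole moves right onto an entry [y] and stays in row [r]. For [j] from [v] to [y.-1],
    removing the hole from [M] has the same effect as replacing [v] by [y]; from [y] on, [M] and
    [M1] agree, and so do the two holes. *)
Lemma slide_right : v <= y ->
  (forall j, v <= j < y -> M j.+1 r.+1 < M j r) ->
  slide M1 y r = slide M v r.
Proof.
move=> vy h; have st := hole_row_stay h.
have eM j q : y <= j -> M1 j q = M j q by move: (M1E j q); lia.
have eh j : y <= j -> hole_row M1 y r j = hole_row M v r j.
  move=> /subnK <-; elim: (j - y) => [|d IH].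
    by rewrite add0n st // (hole_row_stay (k := y)) // => j'; lia.
  rewrite addSn /= IH ltnNge leq_addl ltnNge (leq_trans vy (leq_addl _ _)) /=.
  by rewrite !eM //; lia.
apply: funext => j; apply: funext => q; rewrite /slide.
have [yj|jy] := leqP y j; first by rewrite eM // eh // (leq_trans vy yj).
rewrite /= subn0 st ?(ltnW jy) //.
by move: (M1E j q); rewrite [y <= j]leqNgt jy andbF andbC; lia.
Qed.

(** As before, except that the last hypothesis makes [hole_row] drop exactly when the hole passes
    the entry [y]. *)
Lemma slide_down : v < y ->
  (forall j, v <= j -> j.+1 < y -> M j.+1 r.+1 < M j r) ->
  M y r.+1 = M y.-1 r ->
  slide M1 y r.+1 = slide M v r.
Proof.
move=> vy h e.
have st : forall j, j <= y.-1 -> hole_row M v r j = r.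
  by apply: hole_row_stay => j /andP[vj jy]; apply: h => //; lia.
have eM j q : y <= j -> M1 j q = M j q by move: (M1E j q); lia.
have eh j : y <= j -> hole_row M1 y r.+1 j = hole_row M v r j.
  move=> /subnK <-; elim: (j - y) => [|d IH].
    rewrite add0n (hole_row_stay (k := y)) //; last by move=> j'; lia.
    case: (y) vy e st => // y' vy e st.
    by rewrite /= ltnNge -ltnS vy /= st // e eqxx addn1.
  rewrite addSn /= IH ltnNge leq_addl ltnNge (leq_trans (ltnW vy) (leq_addl _ _)) /=.
  by rewrite !eM //; lia.
apply: funext => j; apply: funext => q; rewrite /slide.
have [yj|jy] := leqP y j; first by rewrite eM // eh // (leq_trans (ltnW vy) yj).
rewrite /= subn0 st //; last by lia.
by move: (M1E j q); rewrite [y <= j]leqNgt jy andbF andbC; lia.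
Qed.

End HoleStep.

Lemma ltn_tab_chain T j q c : all (sorted leq) T ->
  (c < tab_chain T j q) = (c < size (nth [::] T q)) && (entry T q c <= j).
Proof. by move=> /sorted_rows sT; apply: ltn_count_sorted. Qed.

Lemma drop_set_row (T : tableau) r w k : r < k ->
  drop k (set_nth [::] T r w) = drop k T.
Proof.
elim: T r k => [|s T IH] [|r] [|k] //= rk; last exact: IH.
by rewrite drop_oversize // size_ncons /= addn1.
Qed.

Lemma tab_chain_set T r c y j q : c < size (nth [::] T r) ->
  tab_chain (set_entry T r c y) j q + ((q == r) && (entry T r c <= j)) =
  tab_chain T j q + ((q == r) && (y <= j)).
Proof.
move=> cs; rewrite /tab_chain /set_entry nth_set_row.
by have [->|_] := eqVneq q r => //=; apply: count_set_nth_le.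
Qed.

(* The hole keeps the entry that has just been moved out of it; with this stale
   copy [entry T r c], the rows remain sorted, and the invariant can be expressed
   by the counts [tab_chain T]. *)
Lemma slide_holeP fuel T r c : all (sorted leq) T -> c < size (nth [::] T r) ->
    size (flatten (drop r.+1 T)) + (size (nth [::] T r) - c) <= fuel ->
    tab_chain T 0 r <= c.+1 -> (forall q, r < q -> tab_chain T 0 q <= c) ->
    (forall q j, r <= q -> entry T r c <= j ->
       tab_chain T j.+1 q.+1 <= tab_chain T j q) ->
    tab_chain T (entry T r c) r.+1 <= c ->
  all (sorted leq) (slide_hole fuel T r c) /\
  tab_chain (slide_hole fuel T r c) = slide (tab_chain T) (entry T r c) r.
Proof.
(* The fuel bounds the cells from the hole to the end of its row together with all cells of the
   lower rows; every move lowers this number. *)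
elim: fuel T r c => [|fuel IH] T r c sT cs lef z0 zq col below; first by lia.
have lt := ltn_tab_chain _ _ _ sT; have sr := (sorted_rows T).1 sT.
set v := entry T r c in col below *.
have rT : r < size T by rewrite ltnNge; apply/negP => le; rewrite nth_default in cs.
have Mv j : v <= j -> c < tab_chain T j r by move=> vj; rewrite lt cs.
have Mv' j : j < v -> tab_chain T j r <= c.
  by move=> jv; rewrite leqNgt lt cs -ltnNge.
have right0 : entry T r c.+1 = 0 -> size (nth [::] T r) = c.+1.
  move=> e; apply/eqP; rewrite eqn_leq cs andbT leqNgt; apply/negP => cs1.
  by have := lt 0 r c.+1; rewrite cs1 e /=; lia.
have below0 : entry T r.+1 c = 0 -> size (nth [::] T r.+1) <= c.
  move=> e; rewrite leqNgt; apply/negP => cs1.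
  by have := lt 0 r.+1 c; rewrite cs1 e /=; have := zq r.+1 (leqnn _); lia.
have rightv : 0 < entry T r c.+1 -> c.+1 < size (nth [::] T r) /\ v <= entry T r c.+1.
  move=> y0; have cs1 : c.+1 < size (nth [::] T r).
    by rewrite ltnNge; apply/negP => le; move: y0; rewrite /entry nth_default.
  by split=> //; have /(sortedP 0) h := sr r; apply: h.
rewrite /=; set y := entry T r c.+1 in right0 rightv *.
set z := entry T r.+1 c in below0 *.
have M1E w j q := tab_chain_set w j q cs.
have sw w : v <= w -> (c.+1 < size (nth [::] T r) -> w <= y) ->
    all (sorted leq) (set_entry T r c w).
  move=> vw wy; apply/sorted_rows => q; rewrite nth_set_row.
  by case: eqP => // _; apply: sorted_set_nth.
have szr w : size (nth [::] (set_entry T r c w) r) = size (nth [::] T r).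
  by rewrite nth_set_row eqxx size_set_nth (maxn_idPr cs).
case: ifP => [/andP[z_gt0 yz]|nbelow].
  have cz : c < size (nth [::] T r.+1).
    by rewrite ltnNge; apply/negP => le; move: z_gt0; rewrite /z /entry nth_default.
  have vz : v < z.
    by rewrite ltnNge; apply/negP => le; move: below; rewrite leqNgt lt cz le.
  have zy : c.+1 < size (nth [::] T r) -> z <= y.
    move=> cs1; case/orP: yz => [/eqP/right0 e|//].
    by move: cs1; rewrite e ltnn.
  have Mz j : j < z -> tab_chain T j r.+1 <= c.
    by move=> jz; rewrite leqNgt lt -/z cz -ltnNge.
  (* Both sides are [c.+1]: the hole ends row [r] among the entries below [z], and [z] ends row
     [r.+1] among the entries up to [z]. This is the condition under which [hole_row] drops. *)
  have Mzr : tab_chain T z r.+1 = tab_chain T z.-1 r.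
    have le1 : tab_chain T z r.+1 <= tab_chain T z.-1 r.
      by have := col r z.-1 (leqnn _); rewrite prednK //; apply; lia.
    have : c < tab_chain T z r.+1 by rewrite lt cz /=.
    have : tab_chain T z.-1 r <= c.+1.
      by rewrite leqNgt lt; apply/negP => /andP[/zy]; rewrite -/y; lia.
    lia.
  have ez : entry (set_entry T r c z) r.+1 c = z.
    by rewrite /entry nth_set_row; case: eqP => //; lia.
  have eM j q : z <= j -> tab_chain (set_entry T r c z) j q = tab_chain T j q.
    move=> zj; have := M1E z j q; rewrite zj -/v (leq_trans (ltnW vz) zj).
    exact: addIn.
  have eMq j q : r < q -> tab_chain (set_entry T r c z) j q = tab_chain T j q.
    by move=> rq; have := M1E z j q; rewrite gtn_eqF //= !addn0.
  have [] := IH (set_entry T r c z) r.+1 c.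
  - by apply: sw => //; apply: ltnW.
  - by rewrite nth_set_row; case: eqP => //; lia.
  - move: lef; rewrite /set_entry drop_set_row //.
    have rT' : r.+1 < size T.
      by rewrite ltnNge; apply/negP => le; rewrite nth_default in cz.
    rewrite (drop_nth [::] rT') /= size_cat.
    by rewrite nth_set_row; case: eqP => [|_]; [lia|]; lia.
  - by rewrite eMq //; apply: leq_trans (zq _ _) _.
  - by move=> q rq; rewrite eMq ?zq //; lia.
  - by move=> q j rq; rewrite ez => zj; rewrite !eM //; [apply: col; lia|lia].
  - rewrite ez eM //; apply: leq_trans (_ : tab_chain T z.-1 r.+1 <= c); last by apply: Mz; lia.
    by have := col r.+1 z.-1; rewrite prednK //; apply; lia.
  rewrite ez => -> ->; split=> //; apply: slide_down => //.
  by move=> j vj jz; apply: leq_ltn_trans (Mz _ jz) (Mv _ vj).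
case: ifP => [y_gt0|].
  have [cs1 vy] := rightv y_gt0.
  (* Ties go to the lower neighbour, so an entry below the hole exceeds [y] strictly. *)
  have My j : j <= y -> tab_chain T j r.+1 <= c.
    move=> jy; rewrite leqNgt lt -/z; apply/negP => /andP[cz zj].
    have z_gt0 : 0 < z by rewrite lt0n; apply/eqP => /below0; lia.
    by move: nbelow; rewrite z_gt0 (leq_trans zj jy) orbT.
  have ez : entry (set_entry T r c y) r c.+1 = y.
    by rewrite /entry nth_set_row eqxx nth_set_nth /=; case: eqP => //; lia.
  have eM j q : y <= j -> tab_chain (set_entry T r c y) j q = tab_chain T j q.
    move=> zj; have := M1E y j q; rewrite zj -/v (leq_trans vy zj).
    exact: addIn.
  have eMq j q : r < q -> tab_chain (set_entry T r c y) j q = tab_chain T j q.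
    by move=> rq; have := M1E y j q; rewrite gtn_eqF //= !addn0.
  have [] := IH (set_entry T r c y) r c.+1.
  - exact: sw.
  - by rewrite szr.
  - by rewrite szr /set_entry drop_set_row //; lia.
  - by have := M1E y 0 r; rewrite eqxx /=; lia.
  - by move=> q rq; rewrite eMq //; apply: leqW; apply: zq.
  - by move=> q j rq; rewrite ez => zj; rewrite !eM //; [apply: col; lia|lia].
  - by rewrite ez eMq //; apply/leqW/My.
  rewrite ez => -> ->; split=> //; apply: slide_right => //.
  by move=> j /andP[vj jy]; apply: leq_ltn_trans (My _ jy) (Mv _ vj).
(* The hole is in an outer corner: [take c] removes exactly its stale entry, and the hole stays in
   row [r] for all larger entries. *)
move/negbT; rewrite -leqNgt leqn0 => /eqP y0.
have z0' : z = 0 by apply/eqP; rewrite -leqn0 leqNgt; move: nbelow; rewrite y0 /=; case: ltnP.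
have sc := right0 y0; have scb := below0 z0'.
have leb j : tab_chain T j r.+1 <= c by apply: leq_trans (count_size _ _) scb.
split.
  apply/sorted_rows => q; rewrite nth_set_row; case: eqP => // _.
  by apply: take_sorted.
apply: funext => j; apply: funext => q; rewrite /slide.
rewrite (hole_row_stay (k := j)) // => [|j' /andP[vj' _]]; last first.
  exact: leq_ltn_trans (leb _) (Mv _ vj').
rewrite /tab_chain nth_set_row; case: eqP => [->|_]; last by rewrite andbF subn0.
rewrite andbT count_le_take // -/(tab_chain T j r).
have [vj|jv] := leqP v j; last by have := Mv' _ jv; lia.
by have := Mv _ vj; have := count_size (fun x => x <= j) (nth [::] T r);
  rewrite -/(tab_chain T j r); lia.
Qed.

Lemma count_prefix (a : pred (seq nat)) (T : tableau) k : k <= size T ->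
  (forall q, a (nth [::] T q) = (q < k)) -> count a T = k.
Proof.
elim: T k => [|s T IH] k /= kT ak; first by case: k kT ak.
case: k kT ak => [|k] kT ak.
  rewrite (ak 0) add0n; apply/eqP; rewrite -leqn0 leqNgt -has_count.
  apply/(has_nthP [::]) => -[q _]; by rewrite (ak q.+1).
by rewrite (ak 0) add1n; congr _.+1; apply: IH => // q; rewrite (ak q.+1).
Qed.

Lemma count_mem0 (s : seq nat) : count_mem 0 s = count (fun x => x <= 0) s.
Proof. by apply: eq_count => x /=; rewrite leqn0. Qed.

(** The zeros form a partition with last row [r], so the number of rows containing a zero locates
    the lowest inner corner. *)
Lemma jdt_slideP (T : tableau) r : all (sorted leq) T -> hchain (tab_chain T) ->
    0 < tab_chain T 0 r -> tab_chain T 0 r.+1 = 0 ->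
  all (sorted leq) (jdt_slide T) /\
  tab_chain (jdt_slide T) = slide (tab_chain T) 0 r.
Proof.
move=> sT hT r_gt0 r1; have [n0 _] := hstrip_noninc (hT 0).
have lt := ltn_tab_chain _ _ _ sT.
have rT : r < size T.
  by rewrite ltnNge; apply/negP => le; move: r_gt0; rewrite /tab_chain nth_default.
have -> : jdt_slide T = slide_hole (size (flatten T)) T r (tab_chain T 0 r).-1.
  rewrite /jdt_slide (count_prefix (k := r.+1)) //= ?count_mem0 // => q.
  have -> : (0 \in nth [::] T q) = (0 < tab_chain T 0 q).
    by rewrite -has_pred1 has_count count_mem0.
  rewrite ltnS; apply/idP/idP => [q0|qr].
    by rewrite leqNgt; apply/negP => rq; have := noninc_le n0 rq; lia.
  by apply: leq_trans (noninc_le n0 qr).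
have e0 : entry T r (tab_chain T 0 r).-1 = 0.
  by have := lt 0 r (tab_chain T 0 r).-1; rewrite prednK // leqnn; case: ltnP; lia.
have zq q : r < q -> tab_chain T 0 q = 0.
  by move=> rq; have := noninc_le n0 rq; lia.
have [] := @slide_holeP (size (flatten T)) T r (tab_chain T 0 r).-1; rewrite ?e0 //.
- have := lt 0 r (tab_chain T 0 r).-1; rewrite prednK // leqnn.
  by case: ltnP => // _ /esym/andP[].
- rewrite -[in leqRHS](cat_take_drop r T) flatten_cat (drop_nth [::] rT) /=.
  by rewrite !size_cat; lia.
- by rewrite prednK.
- by move=> q /zq ->.
- by move=> q j _ _; case/andP: (hT j q).
- by rewrite r1.
Qed.

(** The [n] cells in row [i] form the strip to be switched. Each slide removes its rightmost cell,
    which by [slide_bkc] does not alter the switched chain; for the empty strip, [bkc] is the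
    identity. *)
Lemma iter_jdt_slide (T : tableau) mu i n : noninc mu ->
    all (sorted leq) T -> hchain (tab_chain T) -> n <= mu i ->
    tab_chain T 0 = (fun q => trunc i mu q + (if q == i then n else 0)) ->
  [/\ all (sorted leq) (iter n jdt_slide T), hchain (tab_chain (iter n jdt_slide T))
    & tab_chain (iter n jdt_slide T) = bkc (tab_chain T) (trunc i mu)].
Proof.
move=> nm; elim: n T => [|n IH] T sT hT ni T0.
  split=> //=; rewrite -[LHS]bkc_id //; congr bkc; rewrite T0.
  by apply: funext => q; case: ifP; rewrite addn0.
have Ti : tab_chain T 0 i = n.+1 by rewrite T0 /trunc ltnn eqxx.
have [] := @jdt_slideP T i sT hT.
- by rewrite Ti.
- by rewrite T0 /trunc ltnNge leqnSn /= gtn_eqF.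
move=> sS eS; rewrite iterSr.
have hX : hstrip (trunc i mu) (tab_chain T 0).
  move=> q; rewrite T0 leq_addr andbT /trunc.
  case: (ltngtP q.+1 i) => qi.
  - by rewrite addn0.
  - by [].
  - by rewrite add0n; apply: leq_trans ni _; rewrite -qi.
have Xq q : q < i -> trunc i mu q = tab_chain T 0 q.
  by move=> qi; rewrite T0 ltn_eqF // addn0.
have Xi : trunc i mu i < tab_chain T 0 i by rewrite Ti /trunc ltnn.
have hS := slide_hchain hT hX Xq Xi.
have bS := slide_bkc hT hX Xq Xi.
rewrite -eS in hS bS; rewrite -bS; apply: IH => //; first exact: ltnW.
rewrite eS /slide T0; apply: funext => q /=.
by case: eqP; rewrite ?subn0 // addnS subn1.
Qed.

Lemma psum_extend f n k : n <= k -> (forall q, n <= q -> f q = 0) ->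
  psum f k = psum f n.
Proof.
by move=> /subnK <- z; elim: (k - n) => // d IH; rewrite addSn psumS IH z ?addn0 ?leq_addl.
Qed.

Lemma count_flatten_rows (a : pred nat) (T : tableau) n : size T <= n ->
  count a (flatten T) = psum (fun q => count a (nth [::] T q)) n.
Proof.
move=> Tn; rewrite (psum_extend Tn); last by move=> q Tq; rewrite nth_default.
elim: T {Tn} => [|s T IH]; first by rewrite psum0.
by rewrite /= count_cat IH /psum big_nat_recl.
Qed.

Lemma count_flatten_chain (T : tableau) j n : (forall q, n <= q -> tab_chain T j q = 0) ->
  count (fun x => x <= j) (flatten T) = psum (tab_chain T j) n.
Proof.
move=> z; rewrite (count_flatten_rows _ (leq_maxl (size T) n)).
by rewrite (@psum_extend _ n) ?leq_maxr.
Qed.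

Lemma Rect_chain L (T : tableau) : tab_chain T 0 \in box L ->
    all (sorted leq) T -> hchain (tab_chain T) ->
  all (sorted leq) (Rect T) /\
  exists2 U, all (sorted leq) U /\ Rect T = [seq row <- U | row != [::]]
    & tab_chain U = rect L (tab_chain T 0) (tab_chain T).
Proof.
move=> Tb sT hT; set mu := tab_chain T 0 in Tb *.
have [nm _] := (mem_box L mu).1 Tb.
pose U := iter (psum mu L) jdt_slide T.
have RU : Rect T = [seq row <- U | row != [::]].
  rewrite /Rect count_mem0 (@count_flatten_chain _ _ L) //.
  by move=> q; apply: (box_eq0 Tb).
suff [sU hU eU] : [/\ all (sorted leq) U, hchain (tab_chain U) &
    tab_chain U = rect L mu (tab_chain T)].
  split; last by exists U.
  by rewrite RU all_filter; apply: sub_all sU => s /= ->; rewrite implybT.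
(* [n] slides have emptied the last [d] rows of [mu], which amounts to [d] rows of the grid. *)
have st d : d <= L -> exists2 n, psum mu L = n + psum mu (L - d) &
    [/\ all (sorted leq) (iter n jdt_slide T),
    hchain (tab_chain (iter n jdt_slide T)) &
    tab_chain (iter n jdt_slide T) = down L (trunc^~ mu) (tab_chain T) d].
  elim: d => [|d IH] dL; first by exists 0; rewrite ?subn0.
  have [n en [s1 h1 e1]] := IH (ltnW dL).
  have eL : L - d = (L - d.+1).+1 by lia.
  exists (mu (L - d.+1) + n); first by rewrite en eL psumS; lia.
  rewrite iterD /=.
  have [] := @iter_jdt_slide (iter n jdt_slide T) mu (L - d.+1) (mu (L - d.+1)) nm s1 h1 (leqnn _).
    rewrite e1; have -> : down L (trunc^~ mu) (tab_chain T) d 0 = trunc (L - d) mu.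
      by case: (d) => [|d'] //=; rewrite ?subn0 trunc_full.
    rewrite eL; apply: funext => q; rewrite /trunc ltnS.
    by case: (ltngtP q (L - d.+1)) => [||->]; rewrite ?addn0.
  by rewrite e1 => *; split.
have [n en h] := st L (leqnn _).
move: en; rewrite subnn psum0 addn0 => en; rewrite /U en.
by case: h => a b c; split=> //; rewrite c /rect /grid subn0.
Qed.

(** * Tableaux and chains *)

Lemma ltn_count_prefix (A : Type) (x0 : A) (a : pred A) s i :
    (forall q, q.+1 < size s -> a (nth x0 s q.+1) -> a (nth x0 s q)) ->
  (i < count a s) = (i < size s) && a (nth x0 s i).
Proof.
elim: s i => [|x s IH] i //= h.
have IH' j := IH j (fun q => h q.+1).
have [ax|nax] := boolP (a x).
  by case: i => [|i] //=; rewrite add1n !ltnS IH'.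
have n0 q : q < size s -> ~~ a (nth x0 s q).
  elim: q => [|q IHq] qs; first by apply: contra nax; apply: (h 0).
  by apply: contra (IHq (ltnW qs)); apply: (h q.+1).
have n1 q : (q < size s) && a (nth x0 s q) = false.
  by apply/negbTE/negP => /andP[/n0/negP].
by rewrite add0n IH' n1; case: i => [|i] /=; rewrite ?(negPf nax) // ltnS n1.
Qed.

Lemma filter_prefix (A : Type) (x0 : A) (a : pred A) s :
    (forall q, q.+1 < size s -> a (nth x0 s q.+1) -> a (nth x0 s q)) ->
  filter a s = take (count a s) s.
Proof.
elim: s => [|x s IH] //= h; have {}IH := IH (fun q => h q.+1).
have [ax|nax] := boolP (a x); first by rewrite add1n /= IH.
have n0 q : q < size s -> ~~ a (nth x0 s q).
  elim: q => [|q IHq] qs; first by apply: contra nax; apply: (h 0).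
  by apply: contra (IHq (ltnW qs)); apply: (h q.+1).
have c0 : count a s = 0.
  apply/eqP; rewrite -leqn0 leqNgt -has_count; apply/(has_nthP x0) => -[q qs].
  by rewrite (negPf (n0 _ qs)).
by rewrite IH c0 take0.
Qed.

Lemma eq_ltn a b : (forall i, (i < a) = (i < b)) -> a = b.
Proof.
move=> h; apply/eqP; rewrite eqn_leq; apply/andP; split; rewrite leqNgt; apply/negP.
  by rewrite h ltnn.
by rewrite -h ltnn.
Qed.

Lemma is_partP (T : tableau) : is_part (shape T) <->
  (forall r, r < size T -> 0 < size (nth [::] T r)) /\
  noninc (fun r => size (nth [::] T r)).
Proof.
split.
  case/andP=> /(sortedP 0) s /allP p; split=> r.
    by move=> rT; apply/p/map_f/mem_nth.
  have [rT|] := ltnP r.+1 (size T); last by move=> rT; rewrite nth_default.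
  by have := s r; rewrite size_map !(nth_map [::]) ?(ltnW rT) //; apply.
case=> p n; apply/andP; split.
  apply/(sortedP 0) => r; rewrite size_map => rT.
  by rewrite !(nth_map [::]) ?(ltnW rT) //; apply: n.
by apply/allP => x /mapP[s /(nthP [::])[r rT <-] ->]; apply: p.
Qed.

Lemma tableau_eq (T T' : tableau) : is_part (shape T) -> is_part (shape T') ->
  (forall r, nth [::] T r = nth [::] T' r) -> T = T'.
Proof.
move=> /is_partP[p _] /is_partP[p' _] e.
apply: (@eq_from_nth _ [::]) => [|i _]; last exact: e.
apply: eq_ltn => i.
have h (U : tableau) : (forall r, r < size U -> 0 < size (nth [::] U r)) ->
    (i < size U) = (0 < size (nth [::] U i)).
  by move=> pU; case: ltnP => [/pU->//|le]; rewrite nth_default.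
by rewrite !h // e.
Qed.

Lemma nth_transpose (T : tableau) c : noninc (fun r => size (nth [::] T r)) ->
  nth [::] (transpose T) c = [seq nth 0 r c | r <- T & c < size r].
Proof.
move=> nT; have [cs|le] := ltnP c (size (transpose T)).
  rewrite (nth_map 0) ?nth_iota ?add0n //; move: cs; rewrite size_map size_iota //.
rewrite nth_default //; move: le; rewrite size_map size_iota => le.
rewrite (@eq_in_filter _ _ pred0) ?filter_pred0 // => s /(nthP [::])[r rT <-].
apply/negbTE; rewrite -leqNgt; apply: leq_trans le.
by rewrite -nth0; apply: (noninc_le nT).
Qed.

Section Transpose.

Variable T : tableau.
Hypothesis pT : is_part (shape T).

Let nT : noninc (fun r => size (nth [::] T r)).
Proof. by case/is_partP: pT. Qed.

Let col_prefix c q : q.+1 < size T ->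
  c < size (nth [::] T q.+1) -> c < size (nth [::] T q).
Proof. by move=> _ h; apply: leq_trans h _; apply: nT. Qed.

Lemma ltn_transpose c r :
  (r < size (nth [::] (transpose T) c)) = (c < size (nth [::] T r)).
Proof.
rewrite nth_transpose // size_map size_filter.
rewrite (@ltn_count_prefix _ [::]); last exact: col_prefix.
by case: ltnP => // le; rewrite nth_default.
Qed.

Lemma entry_transpose c r : entry (transpose T) c r = entry T r c.
Proof.
have [rc|le] := ltnP r (size (nth [::] (transpose T) c)); last first.
  rewrite /entry nth_default // nth_default //.
  by rewrite leqNgt -ltn_transpose -leqNgt.
move: (rc); rewrite /entry nth_transpose // size_map => rc'.
rewrite (nth_map [::]) //; move: rc'.
rewrite (@filter_prefix _ [::]) => [rc'|]; last exact: col_prefix.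
by move: rc'; rewrite size_take_min leq_min => /andP[? _]; rewrite nth_take.
Qed.

Lemma transpose_part : is_part (shape (transpose T)).
Proof.
apply/is_partP; split=> [c|c].
  rewrite size_map size_iota -nth0 => cs.
  by apply: leq_ltn_trans (_ : 0 < _) => //; rewrite ltn_transpose.
rewrite leqNgt; apply/negP; rewrite ltn_transpose => h.
by have := ltn_transpose c (size (nth [::] (transpose T) c)); rewrite ltnn ltnW.
Qed.

End Transpose.

Lemma transposeK T : is_part (shape T) -> transpose (transpose T) = T.
Proof.
move=> pT; have pT' := transpose_part pT.
apply: tableau_eq => //; first exact: transpose_part.
move=> r; apply: (@eq_from_nth _ 0) => [|c _].
  by apply: eq_ltn => c; rewrite !ltn_transpose.
exact: etrans (entry_transpose pT' r c) (entry_transpose pT c r).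
Qed.

Lemma sorted_transpose (R : rel nat) T : is_part (shape T) ->
  all (sorted R) (transpose T) <->
  forall r c, c < size (nth [::] T r.+1) -> R (entry T r c) (entry T r.+1 c).
Proof.
move=> pT; split.
  move=> /(all_nthP [::]) h r c cs.
  have rc : r.+1 < size (nth [::] (transpose T) c) by rewrite ltn_transpose.
  have cT : c < size (transpose T).
    by rewrite ltnNge; apply/negP => le; rewrite nth_default in rc.
  have /(sortedP 0)/(_ _ rc) := h c cT.
  by rewrite -![nth 0 (nth _ _ _) _]/(entry _ _ _) !entry_transpose.
move=> h; apply/(all_nthP [::]) => c _; apply/(sortedP 0) => r rc.
rewrite -![nth 0 (nth _ _ _) _]/(entry _ _ _) !entry_transpose //.
by apply: h; rewrite -ltn_transpose.
Qed.

Lemma sorted_rowsP (R : rel nat) T : all (sorted R) T <->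
  forall r c, c.+1 < size (nth [::] T r) -> R (entry T r c) (entry T r c.+1).
Proof.
split=> [/(all_nthP [::]) h r c cs|h].
  have rT : r < size T by rewrite ltnNge; apply/negP => le; rewrite nth_default in cs.
  by have /(sortedP 0) := h r rT; apply.
by apply/(all_nthP [::]) => r rT; apply/(sortedP 0) => c; apply: h.
Qed.

Lemma count_flatten_entry (a : pred nat) T n : size T <= n ->
  (forall r, size (nth [::] T r) <= n) ->
  count a (flatten T) = \sum_(r < n) \sum_(c < n)
    ((c < size (nth [::] T r)) && a (entry T r c)).
Proof.
move=> Tn sn; rewrite (count_flatten_rows _ Tn) /psum big_mkord.
apply: eq_bigr => r _; rewrite /entry; move: (nth [::] T r) (sn r) => s sl.
have -> : count a s = \sum_(c < size s) a (nth 0 s c).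
  by rewrite -sum1_count big_mkcond (big_nth 0) big_mkord; apply: eq_bigr => c _; case: (a _).
rewrite (big_ord_widen _ (fun c => a (nth 0 s c) : nat) sl) big_mkcond.
by apply: eq_bigr => c _; case: ifP.
Qed.

Lemma count_flatten_transpose (a : pred nat) T : is_part (shape T) ->
  count a (flatten (transpose T)) = count a (flatten T).
Proof.
move=> pT; pose n := maxn (size T) (size (head [::] T)).
have [_ nT] := (is_partP T).1 pT.
rewrite !(@count_flatten_entry _ _ n).
- rewrite exchange_big; apply: eq_bigr => r _; apply: eq_bigr => c _.
  by rewrite ltn_transpose // entry_transpose.
- by rewrite leq_maxl.
- move=> r; rewrite leq_max -nth0; apply/orP; right.
  exact: (@noninc_le (fun r => size (nth [::] T r)) 0 r).
- by rewrite size_map size_iota leq_maxr.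
move=> r; rewrite leqNgt ltn_transpose //; apply/negP.
by rewrite nth_default // leq_maxl.
Qed.

Lemma sorted_count_eq s1 s2 : sorted leq s1 -> sorted leq s2 ->
  (forall j, count (fun x => x <= j) s1 = count (fun x => x <= j) s2) -> s1 = s2.
Proof.
move=> ss1 ss2 e; apply: (sorted_eq leq_trans anti_leq) => //.
(* The multiplicity of [x] is the difference of the counts up to [x] and up to its predecessor. *)
have cm x s : count_mem x s + (if x is x'.+1 then count (fun y => y <= x') s else 0)
    = count (fun y => y <= x) s.
  elim: s => [|y s IH] /=; first by case: x.
  by rewrite -IH; case: x {IH} => [|x] /=; lia.
apply/allP => x _ /=; apply/eqP.
have h1 := cm x s1; have h2 := cm x s2; rewrite e in h1.
by case: x h1 h2 => [|x]; rewrite ?e => h1 h2; exact: addIn (etrans h1 (esym h2)).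
Qed.

Lemma tab_chain_inj T T' : is_part (shape T) -> is_part (shape T') ->
  all (sorted leq) T -> all (sorted leq) T' -> tab_chain T = tab_chain T' -> T = T'.
Proof.
move=> pT pT' /sorted_rows sT /sorted_rows sT' e; apply: tableau_eq => // r.
by apply: sorted_count_eq => // j; apply: (congr1 (fun M : chain => M j r) e).
Qed.

(** * The tableau of a chain *)

Section RowTableau.

Variables (K N : nat) (M : chain).
Hypotheses (M0 : M 0 = rows0) (nM : forall v, noninc (M v)).
Hypotheses (leM : forall v r, M v r <= M v.+1 r) (sM : stable K M).
Hypothesis zM : forall r, N <= r -> M K r = 0.

(* The entry in column [c] of row [r] is the least [v] with [c < M v r]. *)
Definition tab_row r := [seq count (fun v => M v r <= c) (iota 0 K) | c <- iota 0 (M K r)].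

(** Only nonempty rows are listed, as [is_part] demands. The section hypotheses fit chains of
    horizontal strips and chains of vertical strips alike. *)
Definition row_tableau : tableau :=
  [seq tab_row r | r <- iota 0 (count (fun r => 0 < M K r) (iota 0 N))].

Let leM' v w r : v <= w -> M v r <= M w r.
Proof. by move=> /subnK <-; elim: (w - v) => // d IH; apply: leq_trans IH (leM _ _). Qed.

Lemma nth_row_tableau r : nth [::] row_tableau r = tab_row r.
Proof.
have e : (r < count (fun r => 0 < M K r) (iota 0 N)) = (0 < M K r).
  rewrite (@ltn_count_prefix _ 0).
    rewrite size_iota; case: (ltnP r N) => [rN|Nr]; first by rewrite nth_iota.
    by rewrite (zM Nr).
  move=> q; rewrite size_iota => qN; rewrite !nth_iota ?(ltnW qN) // !add0n.
  by move=> h; apply: leq_trans h (nM _ _).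
have [rs|le] := ltnP r (size row_tableau).
  rewrite (nth_map 0) ?nth_iota //; move: rs; rewrite size_map ?size_iota //.
rewrite nth_default //; move: le; rewrite size_map size_iota leqNgt e -leqNgt leqn0.
by rewrite /tab_row => /eqP ->.
Qed.

Lemma size_row_tableau r : size (nth [::] row_tableau r) = M K r.
Proof. by rewrite nth_row_tableau size_map size_iota. Qed.

Lemma entry_row_tableau r c v : c < M K r ->
  (entry row_tableau r c <= v) = (c < M v r).
Proof.
move=> cs; rewrite /entry nth_row_tableau (nth_map 0) ?size_iota //.
rewrite nth_iota // add0n leqNgt (@ltn_count_prefix _ 0); last first.
  move=> q; rewrite size_iota => qK; rewrite !nth_iota ?(ltnW qK) // !add0n.
  by apply: leq_trans (leM _ _).
rewrite size_iota; have [vK|Kv] := ltnP v K.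
  by rewrite nth_iota // add0n -ltnNge.
by rewrite (sM Kv) cs.
Qed.

Lemma row_tableau_part : is_part (shape row_tableau).
Proof.
apply/is_partP; split=> r.
  rewrite size_row_tableau size_map size_iota (@ltn_count_prefix _ 0).
    by rewrite size_iota => /andP[rN]; rewrite nth_iota.
  move=> q; rewrite size_iota => qN; rewrite !nth_iota ?(ltnW qN) // !add0n.
  by move=> h; apply: leq_trans h (nM _ _).
by rewrite !size_row_tableau; apply: nM.
Qed.

Lemma row_tableau_rows : all (sorted leq) row_tableau.
Proof.
apply/sorted_rowsP => r c; rewrite size_row_tableau => cs.
rewrite entry_row_tableau ?(ltnW cs) //.
have := leqnn (entry row_tableau r c.+1); rewrite entry_row_tableau //; exact: ltnW.
Qed.

Lemma row_tableau_cols : all (sorted leq) (transpose row_tableau).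
Proof.
apply/sorted_transpose; first exact: row_tableau_part.
move=> r c; rewrite size_row_tableau => cs.
rewrite entry_row_tableau; last exact: leq_trans cs (nM _ _).
have := leqnn (entry row_tableau r.+1 c); rewrite entry_row_tableau // => h.
exact: leq_trans h (nM _ _).
Qed.

Lemma row_tableau_entries : all (all (fun x => 1 <= x <= K)) row_tableau.
Proof.
apply/(all_nthP [::]) => r _; apply/(all_nthP 0) => c.
rewrite size_row_tableau => cs; rewrite -[nth 0 _ _]/(entry _ _ _).
by rewrite entry_row_tableau // cs andbT ltnNge entry_row_tableau // M0.
Qed.

Lemma tab_chain_row_tableau : tab_chain row_tableau = M.
Proof.
apply: funext => v; apply: funext => r; apply: eq_ltn => c.
rewrite ltn_tab_chain ?row_tableau_rows // size_row_tableau.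
case: ltnP => [cs|le]; first by rewrite entry_row_tableau.
apply/esym/negbTE; rewrite -leqNgt; apply: leq_trans le.
by have [/leM'//|/ltnW /sM ->] := leqP v K.
Qed.

End RowTableau.

Lemma tab_chain_noninc T : is_part (shape T) -> all (sorted leq) T ->
  all (sorted leq) (transpose T) -> forall v, noninc (tab_chain T v).
Proof.
move=> pT sT /sorted_transpose-/(_ pT) cT v r; rewrite leqNgt; apply/negP.
rewrite ltn_tab_chain // => /andP[cs le].
have [_ nT] := (is_partP T).1 pT.
have : tab_chain T v r < tab_chain T v r.
  rewrite ltn_tab_chain //.
  by rewrite (leq_trans cs (nT r)) /=; apply: leq_trans (cT _ _ cs) le.
by rewrite ltnn.
Qed.

Lemma tab_chain_le T v r : tab_chain T v r <= tab_chain T v.+1 r.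
Proof. by apply: sub_count => x /leqW. Qed.

Lemma tab_chain0 T K : all (all (fun x => 1 <= x <= K)) T -> tab_chain T 0 = rows0.
Proof.
move=> aT; apply: funext => r; apply/eqP; rewrite -leqn0 leqNgt -has_count.
apply/(has_nthP 0) => -[c cs]; have [rT|le] := ltnP r (size T); last first.
  by rewrite nth_default in cs.
by have /(all_nthP [::])/(_ r rT)/(all_nthP 0)/(_ c cs) := aT; lia.
Qed.

Lemma tab_chain_full T K v r : all (all (fun x => 1 <= x <= K)) T -> K <= v ->
  tab_chain T v r = size (nth [::] T r).
Proof.
move=> aT Kv; apply/eqP; rewrite -all_count; apply/(all_nthP 0) => c cs.
have rT : r < size T by rewrite ltnNge; apply/negP => le; rewrite nth_default in cs.
by have /(all_nthP [::])/(_ r rT)/(all_nthP 0)/(_ c cs) := aT; lia.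
Qed.

Lemma tab_chain_hchain T : is_part (shape T) -> all (sorted leq) T ->
    tab_chain T 0 = rows0 ->
  all (sorted ltn) (transpose T) <-> hchain (tab_chain T).
Proof.
move=> pT sT T0; have [_ nT] := (is_partP T).1 pT.
split=> [/sorted_transpose-/(_ pT) cT|hT].
  move=> v r; rewrite tab_chain_le andbT leqNgt; apply/negP.
  rewrite ltn_tab_chain // => /andP[cs le].
  have : tab_chain T v r < tab_chain T v r.
    rewrite ltn_tab_chain //.
    by rewrite (leq_trans cs (nT r)) /= -ltnS; apply: leq_trans (cT _ _ cs) le.
  by rewrite ltnn.
apply/sorted_transpose => // r c cs.
have := ltn_tab_chain (entry T r.+1 c) r.+1 c sT; rewrite cs leqnn /=.
case e : (entry T r.+1 c) => [|v]; first by rewrite T0.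
move=> h; rewrite /= ltnS.
have : c < tab_chain T v r by apply: leq_trans h _; case/andP: (hT v r).
by rewrite ltn_tab_chain // => /andP[].
Qed.

Lemma tab_chain_vstrip T : all (sorted leq) T -> tab_chain T 0 = rows0 ->
  all (sorted ltn) T <-> forall v, vstrip (tab_chain T v) (tab_chain T v.+1).
Proof.
move=> sT T0; have lt v r c := ltn_tab_chain v r c sT.
split=> [/sorted_rowsP st v r|h].
  rewrite tab_chain_le /= leqNgt; apply/negP; rewrite lt => /andP[cs le].
  have : tab_chain T v r < tab_chain T v r.
    rewrite ltn_tab_chain //.
    by rewrite (ltnW cs) /= -ltnS; apply: leq_trans (st _ _ cs) le.
  by rewrite ltnn.
apply/sorted_rowsP => r c cs; rewrite /= ltnNge; apply/negP => le.
case e : (entry T r c) => [|v].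
  by have := lt 0 r c; rewrite T0 e (ltnW cs).
have h1 : c.+1 < tab_chain T v.+1 r by rewrite lt cs -e.
have h2 : tab_chain T v r <= c by rewrite leqNgt lt e ltnn andbF.
by have := h v r; lia.
Qed.

(** Transposition makes the columns strict, so a conjugate tableau becomes a chain of horizontal
    strips, and a semistandard one a chain of vertical strips. *)
Definition col_chain (T : tableau) : chain := tab_chain (transpose T).

Lemma shape_eq (T T' : tableau) : is_part (shape T) -> is_part (shape T') ->
  (forall r, size (nth [::] T r) = size (nth [::] T' r)) -> shape T = shape T'.
Proof.
move=> pT pT' e.
have h (U : tableau) : is_part (shape U) -> forall i,
    (i < size U) = (0 < size (nth [::] U i)).
  by move=> /is_partP[pU _] i; case: ltnP => [/pU->//|le]; rewrite nth_default.
have sz : size T = size T' by apply: eq_ltn => i; rewrite !h // e.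
apply: (@eq_from_nth _ 0) => [|i]; rewrite !size_map // => iT.
by rewrite !(nth_map [::]) ?e -?sz.
Qed.

Lemma all_transpose (a : pred nat) T : is_part (shape T) ->
  all (all a) (transpose T) = all (all a) T.
Proof.
move=> pT; have h (U : tableau) : all (all a) U =
    (count a (flatten U) == count predT (flatten U)).
  by rewrite count_predT -all_count; elim: U => //= s U ->; rewrite all_cat.
by rewrite !h !count_flatten_transpose.
Qed.

Section Columns.

Variables (L : nat) (T : tableau).
Hypotheses (pT : is_part (shape T)) (sT : sumn (shape T) < L).

Lemma size_transpose_le : size (transpose T) <= L.
Proof.
rewrite size_map size_iota; apply: leq_trans (ltnW sT).
by case: (T) => //= s T'; rewrite leq_addr.
Qed.

Lemma psum_col_chain v : psum (col_chain T v) L = count (fun x => x <= v) (flatten T).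
Proof.
rewrite -(count_flatten_transpose _ pT) (@count_flatten_chain _ _ L) // => q Lq.
rewrite /tab_chain nth_default //.
exact: leq_trans size_transpose_le Lq.
Qed.

Lemma count_mem_col_chain v :
  psum (col_chain T v.+1) L = psum (col_chain T v) L + count_mem v.+1 (flatten T).
Proof.
rewrite !psum_col_chain; elim: (flatten T) => //= x s ->.
by rewrite eqn_leq; lia.
Qed.

Lemma psum_cols : psum (fun c => size (nth [::] (transpose T) c)) L = sumn (shape T).
Proof.
rewrite -size_flatten -(count_predT (flatten T)) -(count_flatten_transpose _ pT).
rewrite (count_flatten_rows _ size_transpose_le).
by apply: eq_psum => q _; rewrite count_predT.
Qed.

Lemma cols_box : (fun c => size (nth [::] (transpose T) c)) \in box L.
Proof.
apply/mem_box; split; last by rewrite psum_cols.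
by case/is_partP: (transpose_part pT).
Qed.

End Columns.

Lemma sub_sorted_ltn (T : tableau) : all (sorted ltn) T -> all (sorted leq) T.
Proof.
by apply: sub_all => s; apply: sub_sorted => x y; apply: ltnW.
Qed.

Definition chain_tab L K (M : chain) : tableau := transpose (row_tableau K L M).

Lemma chain_noninc L mu al M v : is_chain L mu al M -> noninc (M v).
Proof. by case=> _ hM _ _ _; case: (hstrip_noninc (hM v)). Qed.

(** * Conjugate tableaux as chains of horizontal strips *)

Section ConjTab.

Variables (L : nat) (c : seq nat).
Hypothesis cL : sumn c < L.

Lemma conj_tabP (T : conj_tab c) :
  [/\ is_part (shape T) /\ sumn (shape T) = sumn c,
      all (all (fun x => 1 <= x <= size c)) T,
      all (sorted ltn) T, all (sorted leq) (transpose T)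
    & forall j, j < size c -> count_mem j.+1 (flatten T) = nth 0 c j].
Proof.
case: T => -[T TP] TQ /=.
have /and3P[pT /eqP sT aT] := TP; have /andP[/andP[rT cT] /eqP ct] := TQ.
split=> // j jc; have := congr1 (nth 0 ^~ j) ct.
by rewrite /= (nth_map 0) ?size_iota // nth_iota.
Qed.

Lemma conj_tab_chain (T : conj_tab c) : is_chain L rows0 c (col_chain T).
Proof.
have [[pT sT] aT rT cT kT] := conj_tabP T.
have sL : sumn (shape T) < L by rewrite sT.
have aT' : all (all (fun x => 1 <= x <= size c)) (transpose T) by rewrite all_transpose.
have T0 := tab_chain0 aT'.
split=> //.
- apply/tab_chain_hchain => //; first exact: transpose_part.
  by rewrite transposeK.
- by move=> j cj; apply: funext => q; rewrite /col_chain !(@tab_chain_full _ (size c)).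
- by move=> j jc; rewrite count_mem_col_chain // kT.
- rewrite psum_col_chain //; apply: leq_ltn_trans (count_size _ _) _.
  by rewrite size_flatten.
Qed.

Lemma col_chainK (T : conj_tab c) : chain_tab L (size c) (col_chain T) = T.
Proof.
have [[pT sT] aT rT cT kT] := conj_tabP T.
have cC := conj_tab_chain T; have [C0 hC sC kC lC] := cC.
have zC r : L <= r -> col_chain T (size c) r = 0 by apply: (box_eq0 (chain_box _ cC)).
have nC v := chain_noninc v cC.
have lC' v r : col_chain T v r <= col_chain T v.+1 r by case/andP: (hC v r).
rewrite -[RHS](transposeK pT); congr transpose; apply: tab_chain_inj => //.
- exact: row_tableau_part.
- exact: transpose_part.
- exact: row_tableau_rows.
- by rewrite tab_chain_row_tableau.
Qed.

Lemma chain_tabP M : is_chain L rows0 c M ->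
  exists2 T : conj_tab c, chain_tab L (size c) M = T & col_chain T = M.
Proof.
move=> cM; have [M0 hM sM kM lM] := cM.
have zM r : L <= r -> M (size c) r = 0 by apply: (box_eq0 (chain_box _ cM)).
have nM v := chain_noninc v cM.
have lM' v r : M v r <= M v.+1 r by case/andP: (hM v r).
set R := row_tableau (size c) L M.
have pR : is_part (shape R) by apply: row_tableau_part.
have rR : all (sorted leq) R by apply: row_tableau_rows.
have eR : tab_chain R = M by apply: tab_chain_row_tableau.
have pT := transpose_part pR; have TK := transposeK pR.
have aR : all (all (fun x => 1 <= x <= size c)) (transpose R).
  by rewrite all_transpose //; apply: row_tableau_entries.
have zR v q : L <= q -> tab_chain R v q = 0.
  rewrite eR => Lq; exact: (box_eq0 (chain_box _ cM)).
have cR v : count (fun x => x <= v) (flatten (transpose R)) = psum (M v) L.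
  rewrite count_flatten_transpose // -eR.
  by apply: count_flatten_chain => q; apply: zR.
have sR : sumn (shape (transpose R)) = sumn c.
  have := chain_size cM; rewrite psum_rows0 add0n => <-; rewrite -cR -size_flatten.
  apply/esym/eqP; rewrite -all_count; apply/allP => x /flattenP[s sR xs].
  by have /allP/(_ x xs)/andP[] := allP aR s sR.
have kR : content (size c) (transpose R) = c.
  apply: (@eq_from_nth _ 0) => [|j]; rewrite size_map size_iota // => jc.
  rewrite (nth_map 0) ?size_iota // nth_iota // add1n.
  have sRL : sumn (shape (transpose R)) < L by rewrite sR.
  have := count_mem_col_chain pT sRL j; rewrite /col_chain TK eR kM //.
  by move/addnI => <-.
have fR : is_filling (sumn c) (size c) (transpose R).
  by rewrite /is_filling pT sR eqxx.
have jR : conjugate_tableau (Filling fR) && (content (size c) (Filling fR) == c).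
  rewrite /= kR eqxx andbT /conjugate_tableau TK rR andbT.
  by apply/tab_chain_hchain; rewrite ?eR.
by exists (exist _ (Filling fR) jR); rewrite //= /col_chain TK.
Qed.

Lemma sum_conj_tab (V : nmodType) (P : pred tableau) (F : tableau -> V) :
  (\sum_(T : conj_tab c | P T) F T =
   \sum_(M <- chains L rows0 c | P (chain_tab L (size c) M))
      F (chain_tab L (size c) M))%R.
Proof.
have rb : rows0 \in box L by apply: rows0_box; case: (L) cL.
rewrite [RHS](perm_big (map (fun T : conj_tab c => col_chain T) (enum {: conj_tab c}))).
  rewrite big_map big_enum_cond.
  by apply: eq_big => T; rewrite ?col_chainK.
rewrite perm_sym; apply: uniq_perm; last 1 first.
- move=> M; apply/mapP/idP => [[T _ ->]|/(chainsP _ _ rb)/chain_tabP[T _ <-]].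
    by apply/chainsP => //; apply: conj_tab_chain.
  by exists T; rewrite ?mem_enum.
- rewrite map_inj_uniq ?enum_uniq // => T T' e.
  have eT : tableau_of_conj_tab T = tableau_of_conj_tab T'.
    by rewrite -(col_chainK T) e col_chainK.
  exact/val_inj/val_inj.
- exact: chains_uniq.
Qed.

End ConjTab.

(** * Semistandard tableaux as chains of vertical strips *)

Section SchurChains.

Variables (L n : nat) (R : comNzRingType) (x : nat -> R).

Local Open Scope ring_scope.

Definition psnoc k (M : chain) (g : rows) : chain :=
  fun j => if (j <= k)%N then M j else g.

(** Unlike [chains], this recursion peels off the last step, as [cschur] does with its last
    variable. *)
Fixpoint vchains k (g : rows) : seq chain :=
  if k is k'.+1 then
    [seq psnoc k' M g | f <- [seq f <- box L | `[<vstrip f g>]], M <- vchains k' f]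
  else if g == rows0 then [:: fun=> rows0] else [::].

Definition is_vchain k (g : rows) (M : chain) :=
  [/\ M 0%N = rows0, forall j, vstrip (M j) (M j.+1),
      forall j, M j \in box L & forall j, (k <= j)%N -> M j = g].

Lemma vchainsP k g M : g \in box L -> (M \in vchains k g) <-> is_vchain k g M.
Proof.
elim: k g M => [|k IH] g M gb /=.
  have [->|ne] := eqVneq g rows0; last first.
    by rewrite in_nil; split=> // -[M0 _ _ /(_ 0%N isT)]; rewrite M0 => e; case/eqP: ne.
  have L0 : (0 < L)%N by case/mem_box: gb; case: (L).
  rewrite inE; split=> [/eqP->|[_ _ _ h]].
    by split=> // j; apply: rows0_box.
  by apply/eqP/funext => j; apply: h.
split.
  case/allpairsPdep => f [N []]; rewrite mem_filter => /andP[/asboolP v fb].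
  move=> /(IH _ _ fb)[N0 vN bN kN] ->; split=> //.
  - move=> j; rewrite /psnoc; case: (ltngtP j k) => [jk|kj|->].
    + exact: vN.
    + by move=> i; rewrite leqnn leqnSn.
    + by rewrite kN.
  - by move=> j; rewrite /psnoc; case: ifP.
  - by move=> j kj; rewrite /psnoc leqNgt kj.
case=> M0 vM bM kM; apply/allpairsPdep.
exists (M k), (fun j => M (minn j k)); split.
- rewrite mem_filter bM andbT; apply/asboolP; have := vM k.
  by rewrite (kM k.+1).
- apply/IH => //; split=> //; first by rewrite min0n.
    move=> j; have [jk|kj] := ltnP j k.
      by rewrite (minn_idPl jk).
    rewrite (minn_idPr (leqW kj)) => i.
    by rewrite leqnn leqnSn.
  by move=> j kj; rewrite (minn_idPr kj).
- apply: funext => j; rewrite /psnoc; case: leqP => [//|kj].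
  by rewrite kM.
Qed.

Lemma vchains_uniq k g : g \in box L -> uniq (vchains k g).
Proof.
elim: k g => [|k IH] g gb /=; first by case: ifP.
apply: allpairs_uniq_dep.
- exact/filter_uniq/box_uniq.
- by move=> f; rewrite mem_filter => /andP[_]; apply: IH.
move=> p q /allpairsPdep[f [N [+ + ->]]] /allpairsPdep[f' [N' [+ + ->]]] /= e.
rewrite !mem_filter => /andP[_ fb] /(vchainsP _ _ fb)[_ _ _ kN].
move=> /andP[_ fb'] /(vchainsP _ _ fb')[_ _ _ kN'].
have eN : N = N'.
  apply: funext => j; have := congr1 (fun M : chain => M (minn j k)) e.
  rewrite /psnoc geq_minr; have [//|kj] := leqP j k.
  by rewrite (kN k) // (kN j (ltnW kj)) (kN' k) // (kN' j (ltnW kj)).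
by rewrite -(kN k) // -(kN' k) // eN.
Qed.

Lemma cschur_vchains k g : g \in box L -> cschur L x k g =
  \sum_(M <- vchains k g) \prod_(i < k) x i ^+ (psum (M i.+1) L - psum (M i) L).
Proof.
elim: k g => [|k IH] g gb /=.
  by case: eqP; rewrite ?big_seq1 ?big_nil ?big_ord0.
rewrite big_allpairs_dep -big_filter big_seq [RHS]big_seq.
apply: eq_bigr => f; rewrite mem_filter => /andP[_ fb].
rewrite IH // mulr_sumr big_seq [RHS]big_seq.
apply: eq_bigr => M /(vchainsP _ _ fb)[_ _ _ kM].
rewrite big_ord_recr /= mulrC /psnoc ltnn leqnn kM //; congr (_ * _).
by apply: eq_bigr => i _; rewrite ltn_ord ltnW.
Qed.

End SchurChains.

(** * Schur functions and the map Dec *)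

Definition xvar n i : {mpoly rat[n]} :=
  (if insub i is Some k then 'X_k else 0)%R.

Lemma xvarE n (k : 'I_n) : xvar n k = ('X_k)%R.
Proof. by rewrite /xvar valK. Qed.

(** [col_chain] is a bijection from the semistandard tableaux onto the chains in [cschur_vchains],
    and the sizes of the strips are the exponents of the monomial. *)
Lemma schurE L n T : is_part (shape T) -> sumn (shape T) < L ->
  schur (shape T) n =
  cschur L (xvar n) n (fun c => size (nth [::] (transpose T) c)).
Proof.
move=> pT sT; have gb := cols_box pT sT; set g := (fun c => _) in gb *.
rewrite cschur_vchains //; set mu := shape T in pT sT *.
pose P := [pred V : filling (sumn mu) n | semistandard V && (shape V == mu)].
have PP (V : filling (sumn mu) n) : P V -> [/\ shape V = mu,
    all (all (fun x => 1 <= x <= n)) V, all (sorted leq) V &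
    all (sorted ltn) (transpose V)].
  by case/andP=> /andP[r c] /eqP sh; case/and3P: (fvalP V).
have monoE (V : filling (sumn mu) n) : P V -> 'X_[tab_monomial n V] =
    (\prod_(i < n) xvar n i ^+ (psum (col_chain V i.+1) L - psum (col_chain V i) L))%R.
  case/PP=> sh _ _ _; rewrite mpolyXE_id; apply: eq_bigr => i _; rewrite xvarE mnmE.
  by rewrite count_mem_col_chain ?sh // addKn.
have chainV (V : filling (sumn mu) n) : P V -> is_vchain L n g (col_chain V).
  case/PP=> sh aV rV cV; have pV : is_part (shape V) by rewrite sh.
  have pV' := transpose_part pV.
  have aV' : all (all (fun x => 1 <= x <= n)) (transpose V) by rewrite all_transpose.
  have V0 := tab_chain0 aV'; have rV' := sub_sorted_ltn cV.
  have fullV j : n <= j -> col_chain V j = g.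
    move=> nj; apply: funext => c; rewrite /col_chain (tab_chain_full _ aV') //.
    have eTV : forall r, size (nth [::] V r) = size (nth [::] T r).
      move=> r; have e (W : tableau) : size (nth [::] W r) = nth 0 (shape W) r.
        have [rW|le] := ltnP r (size W); first by rewrite (nth_map [::]).
        by rewrite !nth_default ?size_map.
      by rewrite !e sh.
    by apply: eq_ltn => r; rewrite !ltn_transpose // eTV.
  split=> //; first exact/tab_chain_vstrip.
  move=> j; apply/mem_box; split.
    by apply: tab_chain_noninc => //; rewrite transposeK.
  rewrite psum_col_chain ?sh //; apply: leq_ltn_trans (count_size _ _) _.
  by rewrite size_flatten -/(shape V) sh.
rewrite [RHS](perm_big (map (fun V : filling (sumn mu) n => col_chain V) (enum P))).
  rewrite big_map big_enum /=; apply: eq_big => V; first by rewrite inE.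
  by move=> PV; apply: monoE.
rewrite perm_sym; apply: uniq_perm; last 1 first.
- move=> M; apply/mapP/idP => [[V]|/(vchainsP _ _ gb) [M0 vM bM kM]].
    by rewrite mem_enum => PV ->; apply/vchainsP => //; apply: chainV.
  have nM v : noninc (M v) by case/mem_box: (bM v).
  have leM v r : M v r <= M v.+1 r by case/andP: (vM v r).
  have sM : stable n M by move=> j nj; rewrite !kM.
  have zM r : L <= r -> M n r = 0 by apply: box_eq0.
  set R := row_tableau n L M.
  have pR : is_part (shape R) by apply: row_tableau_part.
  have rR : all (sorted leq) R by apply: row_tableau_rows.
  have cR : all (sorted leq) (transpose R) by apply: row_tableau_cols.
  have eR : tab_chain R = M by apply: tab_chain_row_tableau.
  have pV := transpose_part pR; have RK := transposeK pR.
  have aR : all (all (fun x => 1 <= x <= n)) (transpose R).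
    by rewrite all_transpose //; apply: row_tableau_entries.
  have shR : shape (transpose R) = mu.
    apply: shape_eq => // r; apply: eq_ltn => c; rewrite ltn_transpose //.
    by rewrite size_row_tableau // kM // /g ltn_transpose.
  have fR : is_filling (sumn mu) n (transpose R) by rewrite /is_filling shR pT eqxx.
  exists (Filling fR); last by rewrite /col_chain /= RK.
  rewrite mem_enum inE /= shR eqxx andbT /semistandard cR RK /=.
  by apply/tab_chain_vstrip; rewrite ?eR.
- rewrite map_inj_in_uniq ?enum_uniq // => V W.
  rewrite !mem_enum => /PP[shV _ rV cV] /PP[shW _ rW cW] e.
  have pV : is_part (shape V) by rewrite shV.
  have pW : is_part (shape W) by rewrite shW.
  apply: val_inj; rewrite /= -(transposeK pV) -(transposeK pW); congr transpose.
  by apply: tab_chain_inj; rewrite ?transpose_part ?sub_sorted_ltn.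
- exact: vchains_uniq.
Qed.

(** The steps of [M] for the [i]-th block of [m] entries; [minn] freezes the chain after the block,
    as [stable] requires. *)
Definition seg m i (M : chain) : chain := fun v => M (i * m + minn v m).

(** The entries that are kept form a Young diagram, because rows and columns of [T] increase; so
    truncation commutes with reading columns. *)
Lemma nth_transpose_skew m i T c : is_part (shape T) ->
    all (sorted ltn) T -> all (sorted leq) (transpose T) ->
  nth [::] (transpose (skew_part m i T)) c =
  [seq x - i * m | x <- nth [::] (transpose T) c & x <= i.+1 * m].
Proof.
move=> pT rT cT; have rT' := sub_sorted_ltn rT.
pose g (row : seq nat) := [seq x - i * m | x <- row & x <= i.+1 * m].
have skE : skew_part m i T = map g T by [].
have nthg r : nth [::] (map g T) r = g (nth [::] T r).
  have [rs|le] := ltnP r (size T); first by rewrite (nth_map [::]).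
  by rewrite !nth_default ?size_map.
have szg row : size (g row) = count (fun x => x <= i.+1 * m) row.
  by rewrite size_map size_filter.
rewrite skE nth_transpose; last first.
  move=> r; rewrite !nthg !szg; exact: (tab_chain_noninc pT rT' cT).
rewrite nth_transpose; last by case/is_partP: pT.
rewrite !filter_map -!map_comp -filter_predI.
have e row : row \in T -> (c < size (g row)) = (c < size row) && (nth 0 row c <= i.+1 * m).
  by move=> rowT; rewrite szg ltn_count_sorted //; apply: (allP rT').
rewrite (@eq_in_filter _ _ (predI (preim (nth 0 ^~ c) (leq^~ (i.+1 * m)))
    (fun row => c < size row))); last first.
  by move=> row rowT /=; rewrite e // andbC.
apply/eq_in_map => row; rewrite mem_filter => /andP[/andP[/= le cs] rowT].
have srow := allP rT' _ rowT.
have cg : c < size (g row) by rewrite e // cs.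
have cf : c < size [seq x <- row | x <= i.+1 * m] by move: cg; rewrite size_map.
rewrite (nth_map 0) //; congr (_ - _).
move: cf; rewrite (@filter_prefix _ 0) => [cf|q qs].
  by move: cf; rewrite size_take_min leq_min => /andP[cf _]; rewrite nth_take.
by apply: leq_trans; move/(sortedP 0): srow; apply.
Qed.

(** [rect] does not mention the content, which is read off here to make [rect_chain] applicable to a
    segment. *)
Lemma rect_segment L mu S m : 0 < L -> mu \in box L -> S 0 = mu -> hchain S ->
    stable m S -> psum (S m) L < L ->
  exists al, size al = m /\ is_chain L mu al S.
Proof.
move=> L0 mub S0 hS sS lS.
exists (mkseq (fun v => psum (S v.+1) L - psum (S v) L) m); rewrite size_mkseq.
split=> //; split; rewrite ?size_mkseq // => j jm; rewrite nth_mkseq // subnKC //.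
by apply/psum_le/hstrip_le.
Qed.

Lemma Dec_componentE L c (T : conj_tab c) m i : sumn c < L ->
  Dec_component m i T =
  chain_tab L m (rect L (col_chain T (i * m)) (seg m i (col_chain T))).
Proof.
move=> cL; have L0 : 0 < L by case: (L) cL.
have [[pT sT] aT rT cT kT] := conj_tabP T.
have cC := conj_tab_chain cL T; have [C0 hC sC kC lC] := cC.
have bC j := chain_box j cC.
rewrite /Dec_component; set X := transpose (skew_part m i T).
set M := col_chain T in C0 hC sC kC lC bC *.
have nthX := fun q => nth_transpose_skew m i q pT rT cT.
have chX : tab_chain X = seg m i M.
  apply: funext => v; apply: funext => q; rewrite /tab_chain nthX count_map count_filter.
  apply: eq_count => x /=; rewrite mulSn; lia.
have rX : all (sorted leq) X.
  apply/sorted_rows => q; rewrite nthX.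
  apply: (homo_sorted (e := leq)) => [x y|]; first exact: leq_sub2r.
  by apply: sorted_filter; [apply: leq_trans | apply: (sorted_rows _).1].
have seg0 : seg m i M 0 = M (i * m) by rewrite /seg min0n addn0.
have hS : hchain (seg m i M).
  move=> v; rewrite /seg; have [vm|mv] := ltnP v m.
    by rewrite (minn_idPl vm) addnS; apply: hC.
  rewrite (minn_idPr (leqW mv)); apply: hstrip_refl.
  by case: (hstrip_noninc (hC (i * m + m))).
have sS : stable m (seg m i M).
  by move=> v mv; rewrite /seg (minn_idPr mv) minnn.
have lS : psum (seg m i M m) L < L by case/mem_box: (bC (i * m + minn m m)).
have [al [em cS]] := rect_segment L0 (bC (i * m)) seg0 hS sS lS.
have cR := rect_chain L0 (bC (i * m)) cS.
set W := rect L _ _ in cR *; have [W0 hW sW kW lW] := cR; rewrite em in sW.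
have [] := @Rect_chain L X _ rX; rewrite chX ?seg0 //.
rewrite -/W => rRX [U [sU eRU] eU]; congr transpose.
have zW r : L <= r -> W m r = 0 by apply: (box_eq0 (chain_box _ cR)).
have nW v := chain_noninc v cR.
have lW' v r : W v r <= W v.+1 r by case/andP: (hW v r).
have nU : noninc (fun r => size (nth [::] U r)).
  (* [j] bounds all entries of both rows, so that counting the entries up to [j] gives the full row
     lengths. *)
  move=> r; pose j := sumn (nth [::] U r) + sumn (nth [::] U r.+1).
  have full s : sumn s <= j -> count (fun x => x <= j) s = size s.
    move=> sj; apply/eqP; rewrite -all_count; apply/allP => x xs.
    by apply: leq_trans sj; rewrite sumnE (perm_big _ (perm_to_rem xs)) big_cons leq_addr.
  rewrite -!full ?leq_addl ?leq_addr //.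
  by have := nW j r; rewrite -eU.
have pU q : q.+1 < size U -> nth [::] U q.+1 != [::] -> nth [::] U q != [::].
  by move=> _; rewrite -!size_eq0 -!lt0n => h; apply: leq_trans h (nU q).
(* The nonempty rows of [U] come first, so [Rect] only drops trailing empty rows. *)
have nthR r : nth [::] (Rect X) r = nth [::] U r.
  rewrite eRU (@filter_prefix _ [::]) //.
  have [rk|kr] := ltnP r (count (fun row => row != [::]) U); first by rewrite nth_take.
  rewrite nth_default; last by rewrite size_take_min geq_min kr.
  have := @ltn_count_prefix _ [::] (fun row => row != [::]) U r pU.
  rewrite ltnNge kr /=; have [rU|Ur] := ltnP r (size U).
    by move/esym/negbT; rewrite negbK => /eqP ->.
  by rewrite nth_default.
have pRX : is_part (shape (Rect X)).
  apply/is_partP; split=> r; last by rewrite !nthR; apply: nU.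
  rewrite eRU => rs; have := mem_nth [::] rs.
  by rewrite mem_filter lt0n size_eq0 => /andP[].
apply: tab_chain_inj => //.
- exact: row_tableau_part.
- exact: row_tableau_rows.
- rewrite tab_chain_row_tableau // -eU.
  by apply: funext => v; apply: funext => r; rewrite /tab_chain nthR.
Qed.

Local Open Scope ring_scope.

(** * Elementary symmetric functions *)

Section Elementary.

Variable L : nat.

Lemma rmorph_cschur (R S : comNzRingType) (phi : {rmorphism R -> S}) x n g :
  phi (cschur L x n g) = cschur L (phi \o x) n g.
Proof.
elim: n g => [|n IH] g /=; first by rewrite rmorph_nat.
by rewrite rmorph_sum; apply: eq_bigr => f _; rewrite rmorphM rmorphXn IH.
Qed.

Lemma eq_cschur (R : comNzRingType) (x y : nat -> R) n g :
  (forall i, (i < n)%N -> x i = y i) -> cschur L x n g = cschur L y n g.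
Proof.
elim: n g => [|n IH] g xy //=; apply: eq_bigr => f _.
by rewrite xy // IH // => i /leqW; apply: xy.
Qed.

(** The product form makes the symmetry in the variables evident. *)
Lemma cschur_row_coef (R : comNzRingType) (x : nat -> R) n a : (a < L)%N ->
  cschur L x n (one_row a) = (\prod_(i < n) (1 + (x i)%:P * 'X))`_a.
Proof.
elim: n a => [|n IH] a aL.
  rewrite big_ord0 coef1.
  have -> : (a == 0)%N = (one_row a == rows0).
    apply/eqP/eqP => [->|e]; first by apply: funext; case.
    by have := congr1 (fun f : rows => f 0%N) e.
  by [].
rewrite cschur_rowS // IH // big_ord_recr /= mulrDr mulr1 coefD mulrA coefMX.
congr (_ + _); case: a aL => [|a] aL //=.
by rewrite coefMC IH 1?ltnW // mulrC.
Qed.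

Lemma cols_nseq a : (fun c => size (nth [::] (transpose (nseq a [:: 0%N])) c)) = one_row a.
Proof.
have pT : is_part (shape (nseq a [:: 0%N])).
  by rewrite /shape map_nseq /is_part all_nseq orbT andbT /=; elim: a => // -[|a].
apply: funext => c; apply: eq_ltn => r; rewrite ltn_transpose // nth_nseq /one_row.
by case: (ltnP r a) => ra; case: c => [|c]; rewrite /= ?ra ?ltn0 // ltnNge ra.
Qed.

Lemma elementaryE a n : (a < L)%N -> elementary a n = cschur L (xvar n) n (one_row a).
Proof.
move=> aL; have sh : shape (nseq a [:: 0%N]) = nseq a 1%N by rewrite /shape map_nseq.
rewrite /elementary -sh (@schurE L) ?cols_nseq // sh.
  by rewrite /is_part all_nseq orbT andbT /=; elim: a {aL sh} => // -[|a].
by rewrite sumn_nseq mul1n.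
Qed.

End Elementary.

Lemma sum_count_mem (s : seq nat) n : (\sum_(i < n) count_mem (val i).+1 s <= size s)%N.
Proof.
have -> : (\sum_(i < n) count_mem (val i).+1 s)%N = count (fun y => 0 < y <= n)%N s.
  elim: n => [|n IH].
    rewrite big_ord0; elim: s => //= y s <-; lia.
  rewrite big_ord_recr /= IH; elim: s {IH} => //= y s <-.
  by lia.
exact: count_size.
Qed.

Lemma elementary_sym a : symfun (elementary a).
Proof.
split=> [n|n|].
- have aa := ltnSn a; rewrite (elementaryE _ aa); apply/issymP => s.
  rewrite (rmorph_cschur _ (msym s)) !(cschur_row_coef _ _ aa).
  apply: (congr1 (fun p : {poly _} => p`_a)).
  rewrite [RHS](reindex_inj (@perm_inj _ s)) /=; apply: eq_bigr => i _.
  by rewrite /= !xvarE /msym mmapX mmap1U.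
- rewrite /drop_last !(@elementaryE a.+1) // rmorph_cschur.
  rewrite cschur_rowS; last exact: ltnSn.
  set y := comp_mpoly _ \o _.
  (* The last variable becomes 0, which removes the second term of [cschur_rowS]. *)
  have yn : y n = 0.
    rewrite /y /= (xvarE (ord_max : 'I_n.+1)) comp_mpolyXU (nth_mktuple _ _ ord_max).
    by rewrite unlift_none.
  have yx i : (i < n)%N -> y i = xvar n i.
    move=> i_n; rewrite /y /= (xvarE (widen_ord (leqnSn n) (Ordinal i_n))).
    rewrite (xvarE (Ordinal i_n)) comp_mpolyXU (nth_mktuple _ _ (widen_ord _ _)).
    case: unliftP => [j e|e].
      congr ('X_ _); apply: val_inj; have := congr1 val e.
      by rewrite /= /bump leqNgt ltn_ord /= => ->.
    by have /= e' := congr1 val e; have := i_n; rewrite {1}e' ltnn.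
  rewrite (eq_cschur _ _ yx); case: (a) => [|a']; first by rewrite addr0.
  by rewrite yn mul0r addr0.
(* [msize] is the degree plus one. *)
exists a.+1 => n; rewrite /elementary /schur.
apply: (big_ind (fun p => msize p <= a.+1)%N) => [|p q hp hq|V /andP[_ /eqP sV]].
- by rewrite msize0.
- by apply: leq_trans (msizeD_le _ _) _; rewrite geq_max hp.
rewrite msizeX ltnS mdegE; under eq_bigr do rewrite mnmE.
apply: leq_trans (sum_count_mem _ _) _.
by rewrite size_flatten sV sumn_nseq mul1n.
Qed.

(** * Iteration over the parts of lambda *)

Section Assembly.

Variables (L m : nat).
Notation chains := (chains L).

Lemma leq_sumn x s : x \in s -> (x <= sumn s)%N.
Proof. by move=> xs; rewrite sumnE (perm_big _ (perm_to_rem xs)) big_cons leq_addr. Qed.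

Definition splice p (M S : chain) : chain :=
  fun j => if (j < p)%N then M j else S (j - p)%N.

Lemma chains_cat (V : nmodType) mu al be (F : chain -> V) :
  \sum_(M <- chains mu (al ++ be)) F M =
  \sum_(M <- chains mu al) \sum_(S <- chains (M (size al)) be)
     F (splice (size al) M S).
Proof.
elim: al mu F => [|a al IH] mu F /=.
  rewrite big_seq1; apply: eq_bigr => S _; congr F.
  by apply: funext => j; rewrite /splice subn0.
rewrite !big_allpairs_dep; apply: eq_bigr => la _.
rewrite (IH la (fun M => F (pcons mu M))); apply: eq_bigr => M _.
apply: eq_bigr => S _; congr F.
by apply: funext => -[|j] //=; rewrite /splice ltnS subSS.
Qed.

Definition decomp k (M : chain) : seq chain :=
  [seq rect L (M (i * m)%N) (seg m i M) | i <- iota 0 k].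

Lemma decomp_splice k mu M S : M 0%N = mu -> stable m M -> S 0%N = M m ->
  decomp k.+1 (splice m M S) = rect L mu M :: decomp k S.
Proof.
move=> M0 sM S0; rewrite /decomp /= -[1%N]addn0 iotaDl -map_comp; congr (_ :: _).
  have -> : splice m M S (0 * m)%N = mu.
    by rewrite mul0n /splice; case: ltnP; rewrite // leqn0 => /eqP m0; rewrite m0 S0 m0.
  congr (rect L mu); apply: funext => v; rewrite /seg mul0n add0n /splice.
  have [vm|mv] := ltnP v m; first by rewrite vm.
  by rewrite ltnn subnn S0 sM.
apply: eq_map => i /=; rewrite add1n mulSn.
have sp j : splice m M S (m + j)%N = S j by rewrite /splice ltnNge leq_addr addKn.
rewrite sp; congr (rect L _ _); apply: funext => v.
by rewrite /seg mulSn -addnA sp.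
Qed.

Fixpoint prod_chains (lam : seq nat) : seq (seq chain) :=
  if lam is l :: lam' then
    [seq U :: Us | U <- chains rows0 (nseq m l), Us <- prod_chains lam']
  else [:: [::]].

Variables (R : comNzRingType) (x : nat -> R) (n : nat).

(* The Littlewood-Richardson rule in Schutzenberger's form, iterated. *)
Lemma sum_decomp mu lam (Q : pred (seq chain)) : mu \in box L ->
    (psum mu L + sumn (content_pow lam m) < L)%N ->
  \sum_(M <- chains mu (content_pow lam m) | Q (decomp (size lam) M))
    cschur L x n (M (size (content_pow lam m))) =
  cschur L x n mu *
  \sum_(Us <- prod_chains lam | Q Us) \prod_(U <- Us) cschur L x n (U m).
Proof.
elim: lam mu Q => [|l lam IH] mu Q mub sL.
  rewrite /= [LHS]big_mkcond [in RHS]big_mkcond !big_seq1 big_nil /decomp /=.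
  by case: ifP; rewrite ?mulr1 ?mulr0.
have L0 : (0 < L)%N by lia.
rewrite [content_pow (l :: lam) m]/(nseq m l ++ content_pow lam m) in sL *.
rewrite sumn_cat in sL; set be := content_pow lam m in sL *.
rewrite big_mkcond chains_cat size_nseq.
pose G (U : chain) := \sum_(Us <- prod_chains lam | Q (U :: Us))
  \prod_(U <- Us) cschur L x n (U m).
transitivity (\sum_(M <- chains mu (nseq m l)) cschur L x n (M m) * G (rect L mu M)).
  rewrite big_seq [RHS]big_seq; apply: eq_bigr => M /(chainsP _ _ mub) cM.
  have [M0 hM sM kM lM] := cM; rewrite size_nseq in sM.
  have Mb := chain_box m cM; have sz := chain_size cM; rewrite size_nseq in sz.
  (* The first component is now fixed inside the predicate; this is why [Q] is arbitrary in the
     induction. *)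
  rewrite -(IH (M m) (fun Us => Q (rect L mu M :: Us))) //; last by rewrite sz -/be -addnA.
  rewrite [RHS]big_mkcond big_seq [RHS]big_seq.
  apply: eq_bigr => S /(chainsP _ _ Mb)[S0 _ _ _ _].
  rewrite (decomp_splice _ M0 sM S0) size_cat size_nseq.
  by rewrite /splice ltnNge leq_addr addKn.
rewrite -(sum_rect_all _ _ L0 mub) /= [X in _ = _ * X]big_mkcond.
rewrite big_allpairs_dep mulr_sumr.
rewrite big_seq [RHS]big_seq; apply: eq_bigr => U /(chainsP _ _ (rows0_box L0)) cU.
under eq_bigr => S /eqP -> do over.
rewrite -mulr_suml; have sl : (psum mu L + sumn (nseq m l) < L)%N.
  by apply: leq_ltn_trans sL; rewrite addnA leq_addr.
have := sum_rect_mul x n mub cU sl; rewrite size_nseq => ->.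
rewrite -mulrA; congr (_ * _); rewrite /G mulr_sumr [LHS]big_mkcond.
by apply: eq_bigr => Us _; rewrite big_cons.
Qed.

(** Distributivity: prescribing the whole list of types imposes one independent condition on each
    factor. *)
Lemma sum_prod_chains (X : eqType) (ty : chain -> X) lam (ss : seq X) (f : chain -> R) :
    size ss = size lam ->
  \sum_(Us <- prod_chains lam | map ty Us == ss) \prod_(U <- Us) f U =
  \prod_(p <- zip lam ss) \sum_(U <- chains rows0 (nseq m p.1) | ty U == p.2) f U.
Proof.
elim: lam ss => [|l lam IH] [|s ss] // sz.
  by rewrite /= big_mkcond big_seq1 eqxx !big_nil.
case: sz => sz; rewrite /= big_cons -IH // big_mkcond big_allpairs_dep mulr_suml.
rewrite [RHS]big_mkcond; apply: eq_bigr => U _ /=.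
have [->|ne] := eqVneq (ty U) s; last first.
  by rewrite big1 // => Us _; rewrite eqseq_cons (negPf ne).
rewrite mulr_sumr [RHS]big_mkcond; apply: eq_bigr => Us _.
by rewrite eqseq_cons eqxx big_cons.
Qed.

End Assembly.

(** * The theorem *)

Lemma fam_sum (I : Type) (r : seq I) (P : pred I) (F : I -> Defs.family) n :
  (\sum_(i <- r | P i) F i) n = \sum_(i <- r | P i) F i n.
Proof. by apply: (big_morph (fun f : Defs.family => f n)). Qed.

Lemma fam_prod (I : Type) (r : seq I) (P : pred I) (F : I -> Defs.family) n :
  (\prod_(i <- r | P i) F i) n = \prod_(i <- r | P i) F i n.
Proof. by apply: (big_morph (fun f : Defs.family => f n)). Qed.

Lemma schur_chain_tab L c n M : (sumn c < L)%N -> is_chain L rows0 c M ->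
  schur (shape (chain_tab L (size c) M)) n = cschur L (xvar n) n (M (size c)).
Proof.
move=> cL cM; have [T -> <-] := chain_tabP cL cM.
have [[pT sT] aT rT cT _] := conj_tabP T.
rewrite (@schurE L) // ?sT //; congr cschur; apply: funext => q.
by rewrite /col_chain (@tab_chain_full _ (size c)) // all_transpose.
Qed.

Lemma Dec_chain_tab L m k c M : (sumn c < L)%N -> is_chain L rows0 c M ->
  Dec m k (chain_tab L (size c) M) = map (chain_tab L m) (decomp L m k M) :> seq tableau.
Proof.
move=> cL cM; have [T -> eM] := chain_tabP cL cM.
apply: (@eq_from_nth _ [::]) => [|i].
  by rewrite size_tuple /decomp !size_map size_iota.
rewrite size_tuple => ik; rewrite (nth_mktuple _ _ (Ordinal ik)) (Dec_componentE _ _ _ cL) eM.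
rewrite (nth_map (fun=> rows0)) ?size_map ?size_iota //.
by rewrite (nth_map 0%N) ?size_iota // nth_iota.
Qed.

Theorem mainTheorem9 (m : nat) (hm : (0 < m)%N)
    (type : tableau -> SYT m) (htype : type_attribution type)
    (k : nat) (F : k.-tuple (SYT m) -> SYT m) (hF : Kronecker_map F)
    (lam : k.-tuple nat) (hlam : is_part lam) (t : SYT m) :
  plethysm (schur (shape t)) (\prod_(i < k) elementary (tnth lam i)) =
  \sum_(T : conj_tab (content_pow lam m) | extended_type type F T == t)
    schur (shape T).
Proof.
rewrite (hF (fun i => elementary (tnth lam i))); last by move=> i; apply: elementary_sym.
apply: functional_extensionality_dep => n; rewrite !fam_sum.
(* [L] exceeds the size of every tableau that occurs, so all partitions lie in [box L]; it does not
   depend on the number [n] of variables. *)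
set c := content_pow lam m; pose L := (sumn c).+1.
have cL : (sumn c < L)%N by [].
have L0 : (0 < L)%N by [].
have rb := rows0_box L0.
pose ty U := type (chain_tab L m U).
pose f U := cschur L (xvar n) n (U m).
have lam_le l : l \in (lam : seq nat) -> (sumn (nseq m l) < L)%N.
  move=> ll; rewrite ltnS /c /content_pow sumn_flatten; apply: leq_sumn.
  by rewrite -map_comp; apply: map_f.
have lhs (ts : k.-tuple (SYT m)) :
    (\prod_(i < k) plethysm (schur (shape (tnth ts i))) (elementary (tnth lam i))) n =
    \sum_(Us <- prod_chains L m lam | map ty Us == ts) \prod_(U <- Us) f U.
  rewrite fam_prod sum_prod_chains ?size_tuple //.
  rewrite (big_nth (0%N, t)) size_zip !size_tuple minnn big_mkord.
  apply: eq_bigr => i _; rewrite nth_zip ?size_tuple //= -!tnth_nth.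
  (* A type attribution speaks only of e_l with l positive; the parts of a partition are. *)
  have lam_gt0 : (0 < tnth lam i)%N by case/andP: hlam => _ /allP; apply; apply: mem_tnth.
  have cl := lam_le _ (mem_tnth i lam).
  rewrite htype // fam_sum.
  rewrite (sum_conj_tab cl (fun T => type T == tnth ts i) (fun T => schur (shape T) n)).
  rewrite big_seq_cond [RHS]big_seq_cond size_nseq.
  apply: eq_bigr => U /andP[/(chainsP _ _ rb) cU _].
  by have := schur_chain_tab n cl cU; rewrite size_nseq.
under eq_bigr do rewrite lhs.
rewrite (exchange_big_dep xpredT) //=.
rewrite (sum_conj_tab cL (fun T => extended_type type F T == t) (fun T => schur (shape T) n)).
(* The types of [Us] form a list in the fibre of [F] over [t]. Since [Us] determines this list, the
   sum over the fibre counts each [Us] at most once. *)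
pose Q (Us : seq chain) := [exists ts : k.-tuple (SYT m), (F ts == t) && (map ty Us == ts)].
transitivity (\sum_(M <- chains L rows0 c | Q (decomp L m (size lam) M))
    cschur L (xvar n) n (M (size c))).
  rewrite sum_decomp ?psum_rows0 ?add0n //.
  rewrite cschur_rows0 // mul1r [RHS]big_mkcond.
  apply: eq_bigr => Us _; rewrite /Q; case: ifPn => [/existsP[ts /andP[Fts /eqP eUs]]|nQ].
    rewrite (big_pred1 ts) // => ts'; apply/andP/eqP => [[_ /eqP e]|->].
      by apply: val_inj; rewrite /= -e eUs.
    by rewrite Fts eUs.
  rewrite big_pred0 // => ts; apply: contraNF nQ => h.
  by apply/existsP; exists ts.
rewrite big_seq_cond [RHS]big_seq_cond.
apply: eq_big => [M|M /andP[/(chainsP _ _ rb) cM _]]; last first.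
  by rewrite schur_chain_tab.
case cM : (M \in _) => //=; move/(chainsP _ _ rb): cM => cM.
have eD := Dec_chain_tab m k cL cM.
rewrite /Q /extended_type size_tuple.
have eT : map ty (decomp L m k M) = map_tuple type (Dec m k (chain_tab L (size c) M)).
  by rewrite /= eD -map_comp.
apply/existsP/eqP => [[ts /andP[/eqP <- /eqP e]]|e].
  by congr F; apply: val_inj; rewrite /= -e eT.
by exists (map_tuple type (Dec m k (chain_tab L (size c) M))); rewrite e eT !eqxx.
Qed.
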